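(* Let $K$ be a field and let $\Delta$ be a pure shellable simplicial complex with vertex set $\{x_1,\dots,x_n\}$. Then the $(s_1,\dots,s_n)$-expansion $\Delta^{(s_1,\dots,s_n)}$ is Cohen-Macaulay over $K$ for all positive integers $s_1,\dots,s_n$.
   Context: Simplicial complexes are finite; $\mathcal{F}(\Delta)$ denotes the set of facets (maximal faces) of $\Delta$, and $[s]=\{1,\dots,s\}$. $\Delta$ is pure if all its facets have the same cardinality. Expansion: for a simplicial complex $\Delta$ with vertex set $\{x_1,\dots,x_n\}$ and positive integers $s_1,\dots,s_n$, the $(s_1,\dots,s_n)$-expansion $\Delta^{(s_1,\dots,s_n)}$ is the simplicial complex with vertex set $\{x_{11},\dots,x_{1s_1},x_{21},\dots,x_{2s_2},\dots,x_{n1},\dots,x_{ns_n}\}$ whose facets are exactly the sets $\{x_{i_1r_1},\dots,x_{i_kr_k}\}$ where $\{x_{i_1},\dots,x_{i_k}\}\in\mathcal{F}(\Delta)$ with $i_1<\cdots<i_k$ and $(r_1,\dots,r_k)\in[s_{i_1}]\times\cdots\times[s_{i_k}]$. Shellable: $\Delta$ is shellable if there exists an ordering $F_1<\cdots<F_m$ of all the facets of $\Delta$ such that for any $i<j$ there exist a vertex $v\in F_j\setminus F_i$ and an index $\ell<j$ with $F_j\setminus F_\ell=\{v\}$. A simplicial complex is Cohen-Macaulay over $K$ if its Stanley-Reisner ring (the polynomial ring over $K$ on its vertices modulo the Stanley-Reisner ideal, generated by the squarefree monomials of non-faces) is a Cohen-Macaulay ring. *)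

(* Defs.v *)
From HB Require Import structures.
From mathcomp Require Import all_boot all_algebra.
From mathcomp Require Import mpoly.
From mathcomp Require Import boolp.
From mathcomp Require Import ring.

Set Implicit Arguments.
Unset Strict Implicit.
Unset Printing Implicit Defensive.

Import GRing.Theory.

Local Open Scope ring_scope.
Local Open Scope quotient_scope.

(* Elements of [V] that are not faces are allowed; the empty set is always a
   face, so the void complex is excluded. *)
Record scomplex (V : finType) := SComplex {
  faces :> {set {set V}};
  faces0 : set0 \in faces;
  facesS : forall F G : {set V}, F \subset G -> G \in faces -> F \in faces
}.

Section Complexes.
Variable V : finType.
Implicit Types (D : scomplex V) (A : {set {set V}}) (F G : {set V}).

Definition facets D : {set {set V}} := [set F | maxset (mem (faces D)) F].

Definition pure D : Prop := {in facets D &, forall F G, #|F| = #|G|}.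

Definition shellable D : Prop :=
  exists2 f : seq {set V}, uniq f /\ f =i facets D &
    forall i j, (i < j < size f)%N ->
      exists2 v, v \in nth set0 f j :\: nth set0 f i &
        exists2 l, (l < j)%N & nth set0 f j :\: nth set0 f l = [set v].

Definition gen_faces A : {set {set V}} :=
  [set F | (F == set0) || [exists G in A, F \subset G]].

Lemma gen_faces0 A : set0 \in gen_faces A.
Proof. by rewrite inE eqxx. Qed.

Lemma gen_facesS A F G :
  F \subset G -> G \in gen_faces A -> F \in gen_faces A.
Proof.
rewrite !inE => sFG /orP[/eqP G0|/exists_inP[H HA sGH]].
  by rewrite -subset0 -G0 sFG.
by apply/orP; right; apply/exists_inP; exists H; rewrite ?(subset_trans sFG).
Qed.

Definition gen_complex A : scomplex V :=
  SComplex (gen_faces0 A) (@gen_facesS A).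

End Complexes.

Section Expansion.
Variables (n : nat) (s : 'I_n -> nat).

(* The vertex x_{ir} of the expansion is the pair [Tagged _ r] with
   r : 'I_(s i), so that indices start from 0. *)
Definition exp_vertex := {i : 'I_n & 'I_(s i)}.

Definition exp_facet (F : {set 'I_n}) (r : {dffun forall i, 'I_(s i)}) :
  {set exp_vertex} := [set Tagged (fun i => 'I_(s i)) (r i) | i in F].

Definition exp_facets (D : scomplex 'I_n) : {set {set exp_vertex}} :=
  [set exp_facet F r | F in facets D, r in [set: {dffun forall i, 'I_(s i)}]].

Definition expansion (D : scomplex 'I_n) : scomplex exp_vertex :=
  gen_complex (exp_facets D).

Lemma tag_exp_facet F r : [set tag x | x in exp_facet F r] = F.
Proof.
apply/setP=> i; apply/imsetP/idP => [[_ /imsetP[j jF ->] -> //]|iF].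
exists (Tagged (fun i => 'I_(s i)) (r i)) => //.
by apply/imsetP; exists i.
Qed.

Lemma facets_expansion (D : scomplex 'I_n) :
  (forall i, (0 < s i)%N) -> facets (expansion D) = exp_facets D.
Proof.
move=> s_gt0; pose r0 := [ffun i => Ordinal (s_gt0 i)] : {dffun forall i, 'I_(s i)}.
have genP G : G \in expansion D -> exists2 H, H \in exp_facets D & G \subset H.
  rewrite inE => /orP[/eqP->|/exists_inP[H HA sGH]]; last by exists H.
  have [F Fmax _] := maxset_exists (faces0 D : (mem (faces D)) set0).
  exists (exp_facet F r0); last exact: sub0set.
  by apply/imset2P; exists F r0; rewrite ?inE.
have facE H : H \in exp_facets D -> H \in expansion D.
  by move=> HA; rewrite inE; apply/orP; right; apply/exists_inP; exists H.
apply/setP=> G; apply/idP/idP.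
  rewrite inE => /maxsetP[/genP[H HA sGH] Gmax].
  by rewrite -(Gmax H (facE _ HA) sGH).
move=> GA; rewrite inE; apply/maxsetP; split; first exact: facE.
move=> B /genP[H HA sBH] sGB.
suff eHG : H = G by apply/eqP; rewrite eqEsubset sGB andbT -eHG.
move: (subset_trans sGB sBH); case/imset2P: GA => F r FD _ ->.
case/imset2P: HA => F' r' F'D _ -> sFF'.
have eF : F' = F.
  move: FD; rewrite inE => /maxsetP[_ Fmax]; apply: Fmax.
    by move: F'D; rewrite inE => /maxsetP[].
  by rewrite -(tag_exp_facet F r) -(tag_exp_facet F' r') imsetS.
rewrite eF in sFF' *; apply/esym/eqP; rewrite eqEcard sFF'.
by rewrite !card_imset ?leqnn // => i j [].
Qed.

End Expansion.

Section StanleyReisner.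
Variables (K : fieldType) (V : finType) (D : scomplex V).

Definition sqfree_monomial (F : {set V}) : {mpoly K[#|V|]} :=
  \prod_(v in F) 'X_(enum_rank v).

Definition SR_ideal : {pred {mpoly K[#|V|]}} :=
  fun p => `[< exists c : {set V} -> {mpoly K[#|V|]},
                 p = \sum_(F | F \notin D) c F * sqfree_monomial F >].

Lemma SR_idealr_closed : idealr_closed SR_ideal.
Proof.
split.
- by apply/asboolP; exists (fun=> 0); rewrite big1 // => F _; rewrite mul0r.
- apply/negP => /asboolP[c /(congr1 (meval (fun=> 0)))].
  rewrite meval1 raddf_sum big1 => [/eqP|F FD]; first by rewrite oner_eq0.
  have [F0|[v vF]] := set_0Vmem F; first by rewrite F0 faces0 in FD.
  by rewrite /= mevalM rmorph_prod (bigD1 v vF) /= mevalXU mul0r mulr0.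
- move=> a u v /asboolP[c ->] /asboolP[d ->]; apply/asboolP.
  exists (fun F => a * c F + d F); rewrite mulr_sumr -big_split /=.
  by apply: eq_bigr => F _; rewrite mulrDl mulrA.
Qed.

HB.instance Definition _ :=
  isIdealr.Build {mpoly K[#|V|]} SR_ideal SR_idealr_closed.

Definition SR_ring : comNzRingType := {ideal_quot SR_ideal}.

End StanleyReisner.

Section Localization.
Variables (R : comNzRingType) (P : prime_idealr R).

Definition frac := {x : R * R | x.2 \notin P}.

Implicit Types x y z : frac.

Lemma denM x y : (sval x).2 * (sval y).2 \notin P.
Proof. by rewrite prime_idealrM negb_or (svalP x) (svalP y). Qed.

Lemma den1 : (1 : R) \notin P.
Proof. by rewrite idealr1. Qed.

Definition mkfrac (a t : R) (tP : t \notin P) : frac :=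
  exist (fun x : R * R => x.2 \notin P) (a, t) tP.

Definition frac_equiv x y : bool :=
  `[< exists2 u, u \notin P &
        u * ((sval x).1 * (sval y).2 - (sval y).1 * (sval x).2) = 0 >].

Lemma frac_equivP x y : reflect (exists2 u, u \notin P &
  u * ((sval x).1 * (sval y).2) = u * ((sval y).1 * (sval x).2))
  (frac_equiv x y).
Proof.
apply: (iffP (asboolP _)) => -[u uP].
  by move/eqP; rewrite mulrBr subr_eq0 => /eqP; exists u.
by move=> e; exists u; rewrite // mulrBr e subrr.
Qed.

Lemma frac_equiv_is_equiv : equiv_class_of frac_equiv.
Proof.
split=> [x|x y|y x z].
- by apply/frac_equivP; exists 1; rewrite ?den1.
- by apply/frac_equivP/frac_equivP => -[u uP e]; exists u.
move=> /frac_equivP[u uP eu] /frac_equivP[w wP ew]; apply/frac_equivP.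
exists (u * w * (sval y).2).
  by rewrite !prime_idealrM !negb_or uP wP (svalP y).
case: x y z eu ew => [[a r] ?] [[b t] ?] [[c q] ?] /= eu ew.
have -> : u * w * t * (a * q) = w * q * (u * (a * t)) by ring.
rewrite eu; have -> : w * q * (u * (b * r)) = u * r * (w * (b * q)) by ring.
by rewrite ew; ring.
Qed.

Canonical frac_equiv_equiv := EquivRelPack frac_equiv_is_equiv.
Canonical frac_equiv_encModRel := defaultEncModRel frac_equiv.

Definition localization := {eq_quot frac_equiv}.

HB.instance Definition _ := EqQuotient.on localization.
HB.instance Definition _ := Choice.on localization.

Definition fracD x y := mkfrac
  ((sval x).1 * (sval y).2 + (sval y).1 * (sval x).2) (denM x y).
Definition fracM x y := mkfrac ((sval x).1 * (sval y).1) (denM x y).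
Definition fracN x := mkfrac (- (sval x).1) (svalP x).

Definition loc0 : localization := lift_cst localization (mkfrac 0 den1).
Definition loc1 : localization := lift_cst localization (mkfrac 1 den1).
Definition locD := lift_op2 localization fracD.
Definition locM := lift_op2 localization fracM.
Definition locN := lift_op1 localization fracN.

Canonical pi_loc0_morph := PiConst loc0.
Canonical pi_loc1_morph := PiConst loc1.

Lemma frac_eqP x y : reflect (exists2 u, u \notin P &
  u * ((sval x).1 * (sval y).2) = u * ((sval y).1 * (sval x).2))
  (x == y %[mod localization]).
Proof. by rewrite piE; apply: frac_equivP. Qed.

Lemma pi_locN : {morph \pi : x / fracN x >-> locN x}.
Proof.
move=> x; unlock locN; apply/eqP/frac_eqP.
have /frac_eqP[u uP e] : x == repr (\pi_localization x) %[mod localization].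
  by rewrite reprK.
by exists u => //=; rewrite !mulNr !mulrN e.
Qed.
Canonical pi_locN_morph := PiMorph1 pi_locN.

Lemma pi_locD : {morph \pi : x y / fracD x y >-> locD x y}.
Proof.
move=> x y; unlock locD; apply/eqP/frac_eqP.
have /frac_eqP[u uP] : x == repr (\pi_localization x) %[mod localization].
  by rewrite reprK.
have /frac_eqP[w wP] : y == repr (\pi_localization y) %[mod localization].
  by rewrite reprK.
move: (repr _) (repr _) => x' y' /= ew eu.
exists (u * w); first by rewrite prime_idealrM negb_or uP.
move: (sval x) (sval y) (sval x') (sval y') eu ew.
move=> [a r] [b t] [a' r'] [b' t'] /= eu ew.
transitivity (w * t * t' * (u * (a * r')) + u * r * r' * (w * (b * t'))).
  by ring.
by rewrite eu ew; ring.
Qed.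
Canonical pi_locD_morph := PiMorph2 pi_locD.

Lemma pi_locM : {morph \pi : x y / fracM x y >-> locM x y}.
Proof.
move=> x y; unlock locM; apply/eqP/frac_eqP.
have /frac_eqP[u uP] : x == repr (\pi_localization x) %[mod localization].
  by rewrite reprK.
have /frac_eqP[w wP] : y == repr (\pi_localization y) %[mod localization].
  by rewrite reprK.
move: (repr _) (repr _) => x' y' /= ew eu.
exists (u * w); first by rewrite prime_idealrM negb_or uP.
move: (sval x) (sval y) (sval x') (sval y') eu ew.
move=> [a r] [b t] [a' r'] [b' t'] /= eu ew.
transitivity ((u * (a * r')) * (w * (b * t'))); first by ring.
by rewrite eu ew; ring.
Qed.
Canonical pi_locM_morph := PiMorph2 pi_locM.

Lemma locDA : associative locD.
Proof.
move=> x y z; rewrite -[x]reprK -[y]reprK -[z]reprK !piE.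
by apply/eqP/frac_eqP; exists 1; rewrite ?den1 //=; ring.
Qed.

Lemma locDC : commutative locD.
Proof.
move=> x y; rewrite -[x]reprK -[y]reprK !piE.
by apply/eqP/frac_eqP; exists 1; rewrite ?den1 //=; ring.
Qed.

Lemma loc0D : left_id loc0 locD.
Proof.
move=> x; rewrite -[x]reprK !piE.
by apply/eqP/frac_eqP; exists 1; rewrite ?den1 //=; ring.
Qed.

Lemma locND : left_inverse loc0 locN locD.
Proof.
move=> x; rewrite -[x]reprK !piE.
by apply/eqP/frac_eqP; exists 1; rewrite ?den1 //=; ring.
Qed.

HB.instance Definition _ :=
  GRing.isZmodule.Build localization locDA locDC loc0D locND.

Lemma locMA : associative locM.
Proof.
move=> x y z; rewrite -[x]reprK -[y]reprK -[z]reprK !piE.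
by apply/eqP/frac_eqP; exists 1; rewrite ?den1 //=; ring.
Qed.

Lemma locMC : commutative locM.
Proof.
move=> x y; rewrite -[x]reprK -[y]reprK !piE.
by apply/eqP/frac_eqP; exists 1; rewrite ?den1 //=; ring.
Qed.

Lemma loc1M : left_id loc1 locM.
Proof.
move=> x; rewrite -[x]reprK !piE.
by apply/eqP/frac_eqP; exists 1; rewrite ?den1 //=; ring.
Qed.

Lemma locMDl : left_distributive locM locD.
Proof.
move=> x y z; rewrite -[x]reprK -[y]reprK -[z]reprK !piE.
by apply/eqP/frac_eqP; exists 1; rewrite ?den1 //=; ring.
Qed.

Lemma loc1_neq0 : loc1 != loc0.
Proof.
rewrite !piE; apply/frac_equivP => -[u uP] /=.
by rewrite mul0r mulr0 !mulr1 => u0; rewrite u0 idealr0 in uP.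
Qed.

HB.instance Definition _ := GRing.Zmodule_isComNzRing.Build localization
  locMA locMC loc1M locMDl loc1_neq0.

End Localization.

Section CohenMacaulay.
Variable R : comNzRingType.
Implicit Types (a : seq R) (m : {pred R}) (d : nat).

Definition ideal_span a (x : R) : Prop :=
  exists c : 'I_(size a) -> R, x = \sum_(i < size a) c i * a`_i.

(* [idealr_closed] only speaks of proper ideals; the unit ideal is spanned
   by 1. *)
Definition noetherian : Prop := forall I : {pred R}, idealr_closed I ->
  exists a, forall x, x \in I <-> ideal_span a x.

Definition maximal_ideal m : Prop := idealr_closed m /\
  forall I : {pred R}, idealr_closed I -> {subset m <= I} -> {subset I <= m}.

Definition regular_sequence a : Prop :=
  (forall i x, (i < size a)%N ->
     ideal_span (take i a) (a`_i * x) -> ideal_span (take i a) x) /\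
  ~ ideal_span a 1.

(* A strictly increasing chain P_0 < ... < P_d of prime ideals. *)
Definition prime_chain d (P : 'I_d.+1 -> {pred R}) : Prop :=
  (forall i, idealr_closed (P i) /\ prime_idealr_closed (P i)) /\
  (forall i j : 'I_d.+1, (i < j)%N ->
     {subset P i <= P j} /\ ~ {subset P j <= P i}).

Definition greatest (A : nat -> Prop) d : Prop :=
  A d /\ forall k, A k -> (k <= d)%N.

Definition krull_dim_is d : Prop :=
  greatest (fun k => exists P : 'I_k.+1 -> {pred R}, prime_chain P) d.

Definition depth_is m d : Prop := greatest (fun k =>
  exists a, [/\ size a = k, {subset a <= m} & regular_sequence a]) d.

Definition cohen_macaulay_local : Prop := noetherian /\
  exists m, [/\ maximal_ideal m,
                (forall m', maximal_ideal m' -> m' =i m) &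
                exists2 d, depth_is m d & krull_dim_is d].

End CohenMacaulay.

Definition cohen_macaulay (R : comNzRingType) : Prop := noetherian R /\
  forall P : prime_idealr R, maximal_ideal P ->
    cohen_macaulay_local (localization P).

Definition cohen_macaulay_over (K : fieldType) (V : finType)
  (D : scomplex V) : Prop := cohen_macaulay (SR_ring K D).

(* Main.v *)
(* By the shelling F_1, ..., F_m, the ideal of the complex generated by
   F_1, ..., F_(j-1) is I_j + (x^R_j), where R_j is the restriction of F_j, and
   (I_j : x^R_j) is the prime P_(F_j) generated by the variables outside F_j.
   Hence a sequence that is regular modulo every P_F is regular modulo the
   Stanley-Reisner ideal.
   Let M be a maximal ideal. By the Nullstellensatz, it contains a monic
   polynomial q_v in each variable x_v, which we take to be x_v if possible.
   For each facet F with P_F inside M, the q_v with v outside F vanish modulo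
   P_F and the others form a regular sequence in any order; in the Noetherian
   local ring this implies that the first d elementary symmetric polynomials in
   the q_v are regular modulo P_F, where d is the common size of the facets.
   (Linear forms would not suffice over a finite field.) So the depth is at
   least d. In general, the depth is at most the Krull dimension, and the latter
   is at most d since a chain of primes starts above some P_F and any d + 1
   elements are algebraically dependent modulo P_F.
   The expansion of a pure shellable complex is again pure and shellable. *)
From HB Require Import structures.
Require Import Defs.
From mathcomp Require Import all_boot all_algebra.
From mathcomp Require Import mpoly boolp ring zify.
From mathcomp Require classical_sets.

Set Implicit Arguments.
Unset Strict Implicit.
Unset Printing Implicit Defensive.

Import GRing.Theory.

Local Open Scope ring_scope.
Local Open Scope quotient_scope.

(** * Ideals *)

Section Ideals.
Variable R : comNzRingType.
Implicit Types (I : R -> Prop) (a b : seq R) (x y z t : R).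

(* Unlike [idealr_closed], the unit ideal is allowed. *)
Definition is_ideal I : Prop :=
  I 0 /\ forall c x y, I x -> I y -> I (c * x + y).

Lemma is_ideal0 : is_ideal (fun x => x = 0).
Proof. by split=> // c x y -> ->; rewrite mulr0 addr0. Qed.

Section Closure.
Variables (I : R -> Prop) (idI : is_ideal I).

Lemma ideal0 : I 0. Proof. by case: idI. Qed.

Lemma idealMl c x : I x -> I (c * x).
Proof. by move=> Ix; rewrite -[c * x]addr0; apply: idI.2 => //; apply: ideal0. Qed.

Lemma idealMr c x : I x -> I (x * c).
Proof. by rewrite mulrC; apply: idealMl. Qed.

Lemma idealD x y : I x -> I y -> I (x + y).
Proof. by rewrite -{2}[x]mul1r; apply: idI.2. Qed.

Lemma idealN x : I x -> I (- x).
Proof. by rewrite -mulN1r; apply: idealMl. Qed.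

Lemma idealB x y : I x -> I y -> I (x - y).
Proof. by move=> Ix /idealN; apply: idealD. Qed.

Lemma ideal_sum (T : Type) (r : seq T) (P : pred T) (F : T -> R) :
  (forall i, P i -> I (F i)) -> I (\sum_(i <- r | P i) F i).
Proof. exact: (big_ind I ideal0 idealD). Qed.

Lemma ideal_cong x y : I (x - y) -> I x <-> I y.
Proof.
move=> Ixy; split=> [Ix|Iy]; last by rewrite -(subrK y x); apply: idealD.
by rewrite -(subKr x y); apply: idealB.
Qed.

End Closure.

(** Coefficients indexed by [nat] do not depend on the length of [a], so they can be reused when a
    generator is appended or removed. *)
Lemma ideal_spanP a x :
  ideal_span a x <-> exists c : nat -> R, x = \sum_(i < size a) c i * a`_i.
Proof.
split=> [[c ->]|[c ->]]; last by exists (fun i => c i).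
exists (fun i => if insub i is Some j then c j else 0).
by apply: eq_bigr => i _; rewrite valK.
Qed.

Lemma ideal_span_ideal a : is_ideal (ideal_span a).
Proof.
split; first by exists (fun=> 0); rewrite big1 // => i _; rewrite mul0r.
move=> e x y [c ->] [d ->]; exists (fun i => e * c i + d i).
by rewrite mulr_sumr -big_split; apply: eq_bigr => i _; rewrite /= mulrDl mulrA.
Qed.

Lemma ideal_span_mem a x : x \in a -> ideal_span a x.
Proof.
move=> /(nthP 0)[i lti <-]; exists (fun j => (j == Ordinal lti)%:R).
rewrite (bigD1 (Ordinal lti)) //= eqxx mul1r big1 ?addr0 // => j /negPf->.
by rewrite mul0r.
Qed.

Lemma ideal_span_sub I a x :
  is_ideal I -> (forall y, y \in a -> I y) -> ideal_span a x -> I x.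
Proof.
move=> idI aI [c ->]; apply: ideal_sum => // i _.
by apply: idealMl => //; apply/aI/mem_nth.
Qed.

(** This is the ideal [I + (t)]. Working with ideals of a fixed ring in place of its quotients
    avoids changing the ring with every element of a regular sequence. *)
Definition adjoin I t : R -> Prop := fun x => exists c, I (x - c * t).

Definition adjoins I b := foldl adjoin I b.

Lemma adjoin_ideal I t : is_ideal I -> is_ideal (adjoin I t).
Proof.
move=> idI; split; first by exists 0; rewrite mul0r subr0; apply: ideal0.
move=> e x y [c cI] [d dI]; exists (e * c + d).
rewrite (_ : _ - _ = e * (x - c * t) + (y - d * t)); last by ring.
exact: idI.2.
Qed.

Lemma adjoins_ideal I b : is_ideal I -> is_ideal (adjoins I b).
Proof. by elim: b I => //= t b IH I /(@adjoin_ideal _ t)/IH. Qed.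

Lemma adjoin_sub I t x : I x -> adjoin I t x.
Proof. by exists 0; rewrite mul0r subr0. Qed.

Lemma adjoin_gen I t c : is_ideal I -> adjoin I t (c * t).
Proof. by exists c; rewrite subrr; apply: ideal0. Qed.

Lemma adjoin_self I t : is_ideal I -> adjoin I t t.
Proof. by move/(@adjoin_gen _ t 1); rewrite mul1r. Qed.

Lemma adjoin_mono I J t x :
  (forall y, I y -> J y) -> adjoin I t x -> adjoin J t x.
Proof. by move=> sIJ [c /sIJ]; exists c. Qed.

Lemma ideal_span_rcons a t x : ideal_span (rcons a t) x <-> adjoin (ideal_span a) t x.
Proof.
split=> [|[c /ideal_spanP[d e]]].
  case/ideal_spanP=> c ->; rewrite size_rcons big_ord_recr /= nth_rcons ltnn eqxx.
  exists (c (size a)); apply/ideal_spanP; exists c; rewrite addrK.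
  by apply: eq_bigr => i _; rewrite nth_rcons ltn_ord.
apply/ideal_spanP; exists (fun i => if i == size a then c else d i).
rewrite size_rcons big_ord_recr /= nth_rcons ltnn eqxx -(subrK (c * t) x) e.
congr (_ + _); apply: eq_bigr => i _.
by rewrite nth_rcons ltn_ord (ltn_eqF (ltn_ord i)).
Qed.

Lemma adjoins_rcons I b t : adjoins I (rcons b t) = adjoin (adjoins I b) t.
Proof. by rewrite /adjoins -cats1 foldl_cat. Qed.

Lemma ideal_spanE a x : ideal_span a x <-> adjoins (fun y => y = 0) a x.
Proof.
elim/last_ind: a x => [|a t IH] x.
  by split=> [[c ->]|/= ->]; [rewrite big_ord0|exists (fun=> 0); rewrite big_ord0].
rewrite adjoins_rcons ideal_span_rcons.
by split; apply: adjoin_mono => y /IH.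
Qed.

Lemma noetherianP :
  noetherian R <->
  forall I, is_ideal I -> exists a, forall x, I x <-> ideal_span a x.
Proof.
split=> [nR I idI|nR I [I0 I1 ID]]; last first.
  by apply: (nR (fun x => x \in I)); split=> // c x y; apply: ID.
have [I1|I1] := pselect (I 1).
  exists [:: 1] => x; split=> _; rewrite -[x]mulr1; last exact: idealMl.
  exact/(idealMl (ideal_span_ideal _))/ideal_span_mem/mem_head.
have [|a aP] := nR (fun x => `[< I x >]).
  split=> [||c x y /asboolP Ix /asboolP Iy]; first exact/asboolP/(ideal0 idI).
    by apply/negP => /asboolP.
  by apply/asboolP/idI.2.
by exists a => x; rewrite -aP; split=> /asboolP.
Qed.

End Ideals.

(** * Noetherian rings *)

Lemma field_noetherian (K : fieldType) : noetherian K.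
Proof.
apply/noetherianP=> I idI; have [[x [Ix x0]]|noI] := pselect (exists x, I x /\ x != 0).
  exists [:: x] => y; split=> _.
    rewrite -[y](mulfVK x0).
    exact/(idealMl (ideal_span_ideal _))/ideal_span_mem/mem_head.
  by rewrite -[y](mulfVK x0); apply: idealMl.
exists [::] => y; split=> [Iy|[c ->]]; last by rewrite big_ord0; apply: ideal0.
have [->|y0] := eqVneq y 0; first exact: (ideal_span_ideal _).1.
by case: noI; exists y.
Qed.

Lemma lift_seq (T U : eqType) (f : T -> U) (P : T -> Prop) (a : seq U) :
  (forall y, y \in a -> exists2 x, P x & f x = y) ->
  exists2 b, forall x, x \in b -> P x & map f b = a.
Proof.
elim: a => [|y a IH] aP; first by exists [::].
have [x Px fx] := aP y (mem_head _ _).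
have [|b bP fb] := IH; first by move=> z za; apply: aP; rewrite inE za orbT.
by exists (x :: b); rewrite /= ?fx ?fb // => z /predU1P[->|/bP].
Qed.

(** * Hilbert's basis theorem *)

Section Hilbert.
Variable R : comNzRingType.
Hypothesis noethR : noetherian R.

Variables (J : {poly R} -> Prop) (idJ : is_ideal J).

Definition coef_ideal n (c : R) : Prop :=
  exists p, [/\ J p, (size p <= n.+1)%N & p`_n = c].

Lemma coef_ideal_ideal n : is_ideal (coef_ideal n).
Proof.
split; first by exists 0; rewrite size_poly0 coef0; split=> //; apply: ideal0.
move=> e _ _ [p [Jp sp <-]] [q [Jq sq <-]]; exists (e%:P * p + q).
rewrite coefD coefCM; split=> //; first exact: idJ.2.
rewrite (leq_trans (size_polyD _ _)) // geq_max sq andbT mul_polyC.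
exact: leq_trans (size_scale_leq _ _) sp.
Qed.

Lemma coef_ideal_shift m n c : coef_ideal m c -> coef_ideal (n + m) c.
Proof.
case=> p [Jp sp <-]; exists ('X^n * p); split; first exact: idealMl.
  rewrite (leq_trans (size_polyMleq _ _)) // size_polyXn addSn /=.
  by rewrite -addnS leq_add2l.
by rewrite coefXnM ltnNge leq_addr /= addKn.
Qed.

(** The [coef_ideal n] increase with [n], as [J] is closed under multiplication by powers of ['X].
    Their union is a finitely generated ideal, and a level that contains its generators contains all
    of it. *)
Lemma coef_ideal_stable :
  exists N, forall n c, coef_ideal n c -> coef_ideal N c.
Proof.
have mono m n c : (m <= n)%N -> coef_ideal m c -> coef_ideal n c.
  by move/subnK <-; apply: coef_ideal_shift.
pose L c := exists n, coef_ideal n c.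
have idL : is_ideal L.
  split; first by exists 0%N; apply: (coef_ideal_ideal 0).1.
  move=> e x y [m mx] [n ny]; exists (maxn m n); apply: (coef_ideal_ideal _).2.
    by apply: mono mx; rewrite leq_maxl.
  by apply: mono ny; rewrite leq_maxr.
have [a aP] := (noetherianP R).1 noethR L idL.
have [N NP] : exists N, forall c, c \in a -> coef_ideal N c.
  have : forall c, c \in a -> L c by move=> c ca; apply/aP/ideal_span_mem.
  elim: (a) => [|c b IH] bL; first by exists 0%N.
  have [n nc] := bL c (mem_head _ _).
  have [|m mb] := IH; first by move=> d db; apply: bL; rewrite inE db orbT.
  exists (maxn n m) => d /predU1P[->|/mb]; last by apply: mono; rewrite leq_maxr.
  by apply: mono nc; rewrite leq_maxl.
exists N => n c nc; apply: (ideal_span_sub (coef_ideal_ideal N) NP).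
by apply/aP; exists n.
Qed.

(** Induction on the bound: elements of [J] whose coefficients of ['X^n] generate [coef_ideal n] are
    added to the generators for smaller sizes. A combination of them cancels the coefficient of
    ['X^n] in [p]. *)
Lemma bounded_generators n : exists2 b, forall p, p \in b -> J p &
  forall p, J p -> (size p <= n)%N -> ideal_span b p.
Proof.
elim: n => [|n [b bJ IH]].
  exists [::] => // p _; rewrite leqn0 size_poly_eq0 => /eqP->.
  exact: (ideal_span_ideal _).1.
have [a aP] := (noetherianP R).1 noethR _ (coef_ideal_ideal n).
have [|q qJ qa] := @lift_seq _ _ (fun p : {poly R} => p`_n)
    (fun p => J p /\ (size p <= n.+1)%N) a.
  by move=> y /ideal_span_mem/aP[p [Jp sp py]]; exists p.
exists (q ++ b) => [p|p Jp sp].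
  by rewrite mem_cat => /orP[/qJ[]|/bJ].
have /aP/ideal_spanP[c pn] : coef_ideal n p`_n by exists p.
have idqb := ideal_span_ideal (q ++ b).
pose r := \sum_(i < size q) (c i)%:P * q`_i.
have Jr : J r.
  by apply: ideal_sum => // i _; apply: idealMl => //; apply: (qJ _ _).1; apply: mem_nth.
have sr : (size r <= n.+1)%N.
  apply: (leq_trans (size_sum _ _ _)); apply/bigmax_leqP => i _.
  rewrite mul_polyC (leq_trans (size_scale_leq _ _)) //.
  by apply: (qJ _ _).2; apply: mem_nth.
rewrite -(subrK r p); apply: idealD => //.
  have: ideal_span b (p - r).
    apply: IH; first exact: idealB.
    apply/leq_sizeP => j; rewrite leq_eqVlt => /predU1P[<-|nj].
      rewrite coefB coef_sum pn -qa size_map; apply/eqP; rewrite subr_eq0; apply/eqP.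
      by apply: eq_bigr => i _; rewrite coefCM (nth_map 0).
    rewrite coefB [p`_j]nth_default ?(leq_trans sp) //.
    by rewrite nth_default ?subrr // (leq_trans sr).
  apply: ideal_span_sub => // y yb; apply: ideal_span_mem.
  by rewrite mem_cat yb orbT.
apply: ideal_sum => // i _; apply: idealMl => //; apply: ideal_span_mem.
by rewrite mem_cat mem_nth.
Qed.

(** If the coefficient ideals are stable from [N] on, generators for size at most [N.+1] suffice: in
    larger degree, the leading term is cancelled by a shifted element of [J] of size at most
    [N.+1]. *)
Lemma poly_ideal_fg : exists b, forall p, J p <-> ideal_span b p.
Proof.
have [N NP] := coef_ideal_stable; have [b bJ bP] := bounded_generators N.+1.
exists b => p; split=> [|]; last exact: ideal_span_sub.
have [n] := ubnP (size p); elim: n p => // n IH p; rewrite ltnS => sp Jp.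
have [/bP|Nn] := leqP (size p) N.+1; first exact.
have n0 : (0 < n)%N by move: sp Nn; clear; lia.
have /NP[q [Jq sq qN]] : coef_ideal n.-1 p`_n.-1 by exists p; rewrite prednK.
have idb := ideal_span_ideal b.
rewrite -(subrK ('X^(n.-1 - N) * q) p); apply: idealD => //; last first.
  by apply: idealMl => //; apply: bP.
apply: IH; last by apply: idealB => //; apply: idealMl.
rewrite -[X in (_ < X)%N](prednK n0) ltnS; apply/leq_sizeP => j nj.
have NleN : (N <= n.-1)%N by move: sp Nn; clear; lia.
have nNj : (n.-1 - N <= j)%N by rewrite (leq_trans _ nj) // leq_subr.
rewrite coefB coefXnM ltnNge nNj /=; move: nj; rewrite leq_eqVlt => /predU1P[<-|nj].
  by rewrite subKn // qN subrr.
rewrite nth_default; last by rewrite (leq_trans sp) // -(prednK n0).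
rewrite nth_default ?subrr // (leq_trans sq) //.
by move: nj NleN nNj; clear; lia.
Qed.

End Hilbert.

Lemma poly_noetherian (R : comNzRingType) : noetherian R -> noetherian {poly R}.
Proof. by move=> nR; apply/noetherianP => J; apply: poly_ideal_fg. Qed.

(* Covers both surjective morphisms and localizations. *)
Definition frac_morph (R A : comNzRingType) (f : R -> A) : Prop :=
  forall z, exists t a, (exists u, u * f t = 1) /\ f t * z = f a.

(** The contraction of an ideal of [A] to [R] is finitely generated. The images of its generators
    span the ideal, since each element of the ideal is a fraction with numerator in the
    contraction. *)
Lemma frac_noetherian (R A : comNzRingType) (f : {rmorphism R -> A}) :
  frac_morph f -> noetherian R -> noetherian A.
Proof.
move=> ff /noetherianP nR; apply/noetherianP => J idJ.
have [|a aP] := nR (fun x => J (f x)).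
  split; first by rewrite rmorph0; apply: ideal0.
  by move=> c x y; rewrite rmorphD rmorphM; apply: idJ.2.
exists (map f a) => z; split=> [Jz|]; last first.
  apply: ideal_span_sub => // _ /mapP[x xa ->].
  exact/aP/ideal_span_mem.
have [t [b [[u ut] tz]]] := ff z.
have /aP/ideal_spanP[c bc] : J (f b) by rewrite -tz; apply: idealMl.
rewrite -[z]mul1r -ut -mulrA tz bc rmorph_sum; apply: idealMl.
  exact: ideal_span_ideal.
apply: ideal_sum => [|i _]; first exact: ideal_span_ideal.
rewrite rmorphM; apply: idealMl; first exact: ideal_span_ideal.
by apply/ideal_span_mem/map_f/mem_nth.
Qed.

(** * Finitely generated algebras *)

Definition subring_pred (A : comNzRingType) (B : A -> Prop) : Prop :=
  [/\ B 1, forall x y, B x -> B y -> B (x - y)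
         & forall x y, B x -> B y -> B (x * y)].

(** With generation phrased through subrings, an element of [s] can be moved into the coefficients
    at once ([generated_eval]). This allows induction on [s] with a varying base ring. *)
Definition generated (R A : comNzRingType) (f : R -> A) (s : seq A) : Prop :=
  forall B : A -> Prop, subring_pred B -> (forall x, B (f x)) ->
    (forall y, y \in s -> B y) -> forall z, B z.

Section Eval.
Variables (R A : comNzRingType) (f : {rmorphism R -> A}) (y : A).

Definition eval_morph (p : {poly R}) : A := (map_poly f p).[y].

Lemma eval_morph_is_zmod_morphism : zmod_morphism eval_morph.
Proof. by move=> p q; rewrite /eval_morph rmorphB hornerD hornerN. Qed.

Lemma eval_morph_is_monoid_morphism : monoid_morphism eval_morph.
Proof.
by split=> [|p q]; rewrite /eval_morph ?rmorph1 ?hornerC // rmorphM hornerM.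
Qed.

HB.instance Definition _ :=
  GRing.isZmodMorphism.Build {poly R} A eval_morph eval_morph_is_zmod_morphism.
HB.instance Definition _ :=
  GRing.isMonoidMorphism.Build {poly R} A eval_morph eval_morph_is_monoid_morphism.

Lemma eval_morphC c : eval_morph c%:P = f c.
Proof. by rewrite /eval_morph map_polyC hornerC. Qed.

Lemma eval_morphX : eval_morph 'X = y.
Proof. by rewrite /eval_morph map_polyX hornerX. Qed.

Lemma generated_eval s : generated f (y :: s) -> generated eval_morph s.
Proof.
move=> gf B subB fB sB; apply: gf => // [x|x /predU1P[->|/sB //]].
  by rewrite -eval_morphC.
by rewrite -eval_morphX.
Qed.

End Eval.

Lemma generated_nil (R A : comNzRingType) (f : {rmorphism R -> A}) :
  generated f [::] -> forall z, exists x, f x = z.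
Proof.
move=> gf; apply: gf => // [|x]; last by exists x.
split=> [|_ _ [x <-] [y <-]|_ _ [x <-] [y <-]]; first by exists 1; rewrite rmorph1.
  by exists (x - y); rewrite rmorphB.
by exists (x * y); rewrite rmorphM.
Qed.

Lemma generated_noetherian (R A : comNzRingType) (f : {rmorphism R -> A}) s :
  generated f s -> noetherian R -> noetherian A.
Proof.
elim: s R f => [|y s IH] R f gf nR.
  apply: (frac_noetherian (f := f)) nR => z; have [x <-] := generated_nil gf z.
  exists 1, x; rewrite rmorph1 mul1r; split=> //.
  by exists 1; rewrite mulr1.
exact: IH (generated_eval gf) (poly_noetherian nR).
Qed.

(** * Algebraicity of finitely generated field extensions *)

Section Nullstellensatz.
Variables (L : comNzRingType) (invL : forall z : L, z != 0 -> exists w, w * z = 1).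

(* The image of [f] becomes a field after inverting a single element. *)
Definition goldman (R : comNzRingType) (f : R -> L) : Prop :=
  exists a, f a != 0 /\
    forall c, f c != 0 -> exists N b, f a ^+ N = f c * f b.

Lemma fieldlike_mulf_neq0 (x y : L) : x != 0 -> y != 0 -> x * y != 0.
Proof.
move=> /invL[w wx]; apply: contraNneq => xy0.
by rewrite -[y]mul1r -wx -mulrA xy0 mulr0.
Qed.

Section Step.
Variables (R : comNzRingType) (f : {rmorphism R -> L}) (y : L).

(* Were [y] transcendental, [1 + X * a] would divide a power of [a] in a
   polynomial ring over a field. *)
Lemma goldman_algebraic : goldman (eval_morph f y) ->
  exists p, map_poly f p != 0 /\ eval_morph f y p = 0.
Proof.
case=> a [a0 aP]; apply: contrapT => noalg.
have transc p : eval_morph f y p = 0 -> map_poly f p = 0.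
  by move=> p0; apply/eqP; apply: contrapT => /negP np; apply: noalg; exists p.
pose P := map_poly f a.
have P0 : P != 0 by apply: contra a0 => /eqP e; rewrite /eval_morph -/P e horner0.
have mapc : map_poly f (1 + 'X * a) = 1 + 'X * P.
  by rewrite rmorphD rmorph1 rmorphM /= map_polyX.
have [|N [b]] := aP (1 + 'X * a).
  apply/eqP => /transc; rewrite mapc => /(congr1 (fun p : {poly L} => p`_0)).
  by rewrite coefD coefXM coef1 coef0 addr0 => /eqP; rewrite oner_eq0.
rewrite -rmorphXn -rmorphM => /eqP; rewrite -subr_eq0 -rmorphB => /eqP/transc/eqP.
rewrite rmorphB rmorphXn rmorphM /= mapc subr_eq0 -/P => /eqP PN.
set C := 1 + 'X * P in PN; set Q := map_poly f b in PN.
(* Modulo [C] one has ['X * P = -1], while [P ^+ N] is a multiple of [C]. So [C] is a unit, although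
   its degree is positive and [L] has no zero divisors. *)
have [D CD] : exists D, C * D = 1.
  have [E DE] : exists E, ('X * P) ^+ N = C * E + (-1) ^+ N.
    elim: N {PN} => [|N [E IH]]; first by exists 0; rewrite mulr0 add0r.
    exists (E * ('X * P) + (-1) ^+ N); rewrite exprSr IH exprSr /C; ring.
  exists ((-1) ^+ N * ('X ^+ N * Q - E)).
  transitivity ((-1) ^+ N * (('X * P) ^+ N - C * E)).
    by rewrite exprMn PN; ring.
  by rewrite DE addrC addKr -exprD addnn -mul2n exprM sqrrN !expr1n.
have sC : size C = (size P).+1.
  rewrite /C addrC size_polyDl; first by rewrite mulrC size_mulX.
  by rewrite size_poly1 mulrC size_mulX // ltnS lt0n size_poly_eq0.
have C0 : lead_coef C != 0 by rewrite lead_coef_eq0 -size_poly_eq0 sC.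
have D0 : lead_coef D != 0.
  rewrite lead_coef_eq0; apply: contra_eq_neq CD => ->.
  by rewrite mulr0 eq_sym oner_neq0.
have := size_proper_mul (fieldlike_mulf_neq0 C0 D0); rewrite CD sC size_poly1.
have := D0; rewrite lead_coef_eq0 -size_poly_gt0.
by move: P0; rewrite -size_poly_gt0; clear; lia.
Qed.

(** With [w] inverse to [f u], the values of [eval_morph f w] form the ring [R[1 / u]], for which
    this map stands from here on. A power of [u] clears the denominators. *)
Lemma eval_clear u w (s : {poly R}) : w * f u = 1 ->
  exists e b, f u ^+ e * eval_morph f w s = f b.
Proof.
move=> wu; elim/poly_ind: s => [|s c [e [b eb]]].
  by exists 0%N, 0; rewrite !rmorph0 mulr0.
exists e.+1, (b + u ^+ e.+1 * c).
rewrite !rmorphD !rmorphM /= eval_morphX eval_morphC rmorphXn /= mulrDr -eb exprSr.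
congr (_ + _); transitivity (f u ^+ e * eval_morph f w s * (w * f u)); first ring.
by rewrite wu mulr1.
Qed.

(** The leading coefficient of [p] may be killed by [f], so [p] is cut off at the size of its
    image. *)
Lemma algebraic_lead : (exists p, map_poly f p != 0 /\ eval_morph f y p = 0) ->
  exists g, f (lead_coef g) != 0 /\ eval_morph f y g = 0.
Proof.
case=> p [p0 py]; pose n := size (map_poly f p).
have n0 : (0 < n)%N by rewrite size_poly_gt0.
have lp : f p`_n.-1 != 0 by rewrite -coef_map -lead_coefE lead_coef_eq0.
exists (\poly_(i < n) p`_i); split.
  by rewrite lead_coef_poly //; apply: contraNneq lp => ->; rewrite rmorph0.
rewrite -py /eval_morph; congr (_.[y]); apply/polyP => i.
rewrite !coef_map coef_poly /=; case: ltnP => // ni.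
by rewrite rmorph0 -coef_map nth_default.
Qed.

Lemma integral_coef u w c : w * f u = 1 -> integralOver (eval_morph f w) (f c).
Proof. by move=> wu; rewrite -(eval_morphC f w); apply: integral_id. Qed.

Lemma integral_inv_coef u w : w * f u = 1 -> integralOver (eval_morph f w) w.
Proof. by move=> wu; rewrite -{2}(eval_morphX f w); apply: integral_id. Qed.

Lemma integral_eval_map u w z h : w * f u = 1 ->
  integralOver (eval_morph f w) z -> integralOver (eval_morph f w) (eval_morph f z h).
Proof.
move=> wu; apply: integral_horner; apply/integral_poly => i.
by rewrite coef_map; apply: integral_coef wu.
Qed.

Lemma integral_algebraic_elt g k w : eval_morph f y g = 0 ->
  w * f (lead_coef g * k) = 1 -> integralOver (eval_morph f w) y.
Proof.
move=> gy wu; pose p := (w * f k) *: map_poly f g.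
have g0 : f (lead_coef g) != 0.
  by apply: contra_eq_neq wu => g0; rewrite rmorphM g0 mul0r mulr0 eq_sym oner_neq0.
apply: (integral_root_monic (p := p)); last 1 first.
- apply/integral_poly => i; rewrite coefZ coef_map; apply: integral_mul.
    by apply: integral_mul; [apply: integral_inv_coef wu|apply: integral_coef wu].
  exact: integral_coef wu.
- have wkg : w * f k * f (lead_coef g) = 1.
    by rewrite -wu rmorphM; ring.
  have sg : size (map_poly f g) = size g by apply: size_map_poly_id0.
  apply/monicP; rewrite lead_coefE; suff -> : size p = size g.
    by rewrite coefZ coef_map -lead_coefE.
  apply/eqP; rewrite eqn_leq -{1}sg size_scale_leq /= leqNgt; apply/negP => ltp.
  have g1 : (0 < size g)%N by rewrite (leq_ltn_trans _ ltp).
  have : p`_(size g).-1 = 0 by rewrite nth_default // -ltnS prednK.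
  by rewrite coefZ coef_map -lead_coefE wkg => /eqP; rewrite oner_eq0.
- by rewrite /root hornerZ -/(eval_morph f y g) gy mulr0.
Qed.

(* Let [c] in [R] divide a power of [a] in [R[y]]. Both [y] and [1 / a] are
   integral over [R[1 / u]] for a suitable [u] independent of [c], hence so is
   [1 / c]; multiplying its integral equation by a power of [c] shows that
   [1 / c] lies in [R[1 / u]]. *)
Lemma goldman_eval : goldman (eval_morph f y) -> goldman f.
Proof.
move=> Gf; have [g [g0 gy]] := algebraic_lead (goldman_algebraic Gf).
case: Gf => a [a0 aP]; set al := eval_morph f y a in a0 aP.
have [w0 w0g] := invL g0.
have inty0 : integralOver (eval_morph f w0) y.
  by apply: (integral_algebraic_elt (k := 1) gy); rewrite mulr1.
have [q mq qr] := integral_eval_map a w0g inty0.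
have exk : exists k, eval_morph f w0 q`_k != 0.
  by exists (size q).-1; rewrite -lead_coefE (monicP mq) rmorph1 oner_neq0.
(* Cancelling [al ^+ k] from the integral equation of [al] leaves a nonzero constant term. Inverting
   its numerator [a1] along with the leading coefficient of [g] makes [1 / al] integral. *)
case: (ex_minnP exk) => k qk kmin.
have [e [a1 a1E]] := eval_clear q`_k w0g.
have a10 : f a1 != 0.
  rewrite -a1E; apply: fieldlike_mulf_neq0 => //.
  by elim: (e) => [|i IH]; rewrite ?oner_neq0 // exprS fieldlike_mulf_neq0.
have u0 : f (lead_coef g * a1) != 0 by rewrite rmorphM fieldlike_mulf_neq0.
have [w wu] := invL u0.
have inty : integralOver (eval_morph f w) y by apply: (integral_algebraic_elt gy wu).
have intal : integralOver (eval_morph f w) al by apply: integral_eval_map wu inty.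
have w0E : w0 = w * f a1.
  by rewrite -[LHS]mulr1 -wu rmorphM -[RHS]mulr1 -w0g; ring.
have intE0 s : integralOver (eval_morph f w) (eval_morph f w0 s).
  apply: (integral_eval_map _ wu); rewrite w0E.
  by apply: integral_mul; [apply: integral_inv_coef wu|apply: integral_coef wu].
pose Q := map_poly (eval_morph f w0) q.
have QE : Q = drop_poly k Q * 'X^k.
  rewrite -[LHS](poly_take_drop k) (_ : take_poly k Q = 0) ?add0r //.
  apply/polyP => i; rewrite coef_take_poly coef0; case: ltnP => // ik.
  by rewrite coef_map; apply/eqP; apply: contraTT ik => /kmin; rewrite -leqNgt.
have [be beal] := invL a0.
have Qal : (drop_poly k Q).[al] = 0.
  move: qr; rewrite -/al -/Q /root {1}QE hornerM hornerXn => /eqP h.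
  transitivity ((be * al) ^+ k * (drop_poly k Q).[al]).
    by rewrite beal expr1n mul1r.
  by rewrite exprMn mulrAC -mulrA h mulr0.
have Qal' : eval_morph f w0 q`_k + al * (drop_poly k.+1 Q).[al] = 0.
  have -> : drop_poly k.+1 Q = drop_poly 1 (drop_poly k Q).
    by apply/polyP => i; rewrite !coef_drop_poly addnAC addn1 addnS.
  rewrite -Qal -[in RHS](poly_take_drop 1 (drop_poly k Q)).
  rewrite hornerD hornerM hornerXn expr1 mulrC; congr (_ + _).
  rewrite [take_poly 1 _](_ : _ = (eval_morph f w0 q`_k)%:P) ?hornerC //; apply/polyP => i.
  rewrite coef_take_poly coefC coef_drop_poly coef_map.
  by case: i => [|i].
set rho := (drop_poly k.+1 Q).[al] in Qal'.
have intrho : integralOver (eval_morph f w) rho.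
  apply: integral_horner intal; apply/integral_poly => i.
  by rewrite coef_drop_poly coef_map; apply: intE0.
have intbe : integralOver (eval_morph f w) be.
  (* The constant term is [- al * rho], and its inverse is [f (lead_coef g) ^+ e / f a1], where
     [1 / f a1] is [w * f (lead_coef g)]. *)
  have -> : be = - rho * (f (lead_coef g) ^+ e * (w * f (lead_coef g))).
    have h : eval_morph f w0 q`_k = - (al * rho) by apply/eqP; rewrite -addr_eq0 Qal'.
    have {}h : f (lead_coef g) ^+ e * (al * - rho) * w * f (lead_coef g) = 1.
      by rewrite mulrN -h a1E -wu rmorphM; ring.
    rewrite -[LHS]mulr1 -h -[RHS]mulr1 -beal; ring.
  apply: integral_mul; first exact: integral_opp.
  apply: integral_mul; first by rewrite -rmorphXn; apply: integral_coef wu.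
  by apply: integral_mul; [apply: integral_inv_coef wu|apply: integral_coef wu].
exists (lead_coef g * a1); split=> // c c0.
have [|N [b bE]] := aP c%:P; first by rewrite eval_morphC.
rewrite eval_morphC in bE.
pose ga := eval_morph f y b * be ^+ N.
have cga : f c * ga = 1 by rewrite mulrA -bE -exprMn mulrC beal expr1n.
have intga : integralOver (eval_morph f w) ga.
  apply: integral_mul; first exact: integral_eval_map wu inty.
  elim: (N) => [|i IH]; first exact: integral1.
  by rewrite exprS; apply: integral_mul.
case: intga => m mm mroot.
have sm : (0 < size m)%N by rewrite size_poly_gt0 monic_neq0.
have [n sn] : exists n, size m = n.+1 by exists (size m).-1; rewrite prednK.
have [s sE] : exists s, f c * eval_morph f w s = 1.
  have smE : size (map_poly (eval_morph f w) m) = n.+1.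
    by rewrite -sn size_map_poly_id0 // (monicP mm) rmorph1 oner_neq0.
  move: mroot; rewrite /root horner_coef smE big_ord_recr /= coef_map /=.
  have -> : m`_n = 1 by rewrite -(monicP mm) lead_coefE sn.
  rewrite rmorph1 mul1r addrC addr_eq0 => /eqP mr.
  case: n {sn smE} mr => [|n] mr.
    by move: mr; rewrite big_ord0 oppr0 => /eqP; rewrite oner_eq0.
  (* Here [ga] is the inverse of [f c]. Its integral equation of degree [n.+1], multiplied by
     [f c ^+ n.+1], writes 1 as [f c] times this sum. *)
  exists (- \sum_(i < n.+1) m`_i * (c ^+ (n - i))%:P).
  rewrite rmorphN rmorph_sum mulrN mulr_sumr.
  transitivity ((f c * ga) ^+ n.+1); last by rewrite cga expr1n.
  rewrite exprMn mr mulrN mulr_sumr; congr (- _); apply: eq_bigr => i _.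
  rewrite coef_map rmorphM /= eval_morphC rmorphXn.
  have -> : f c ^+ n.+1 = f c * f c ^+ (n - i) * f c ^+ i.
    by rewrite -exprS -exprD addSn subnK // -ltnS.
  transitivity (f c * f c ^+ (n - i) * eval_morph f w m`_i * (f c * ga) ^+ i).
    by rewrite cga expr1n mulr1; ring.
  by rewrite exprMn; ring.
have [e' [b' b'E]] := eval_clear s wu.
exists e', b'; rewrite -b'E mulrCA sE mulr1 //.
Qed.

End Step.

Lemma generated_goldman (R : comNzRingType) (f : {rmorphism R -> L}) s :
  generated f s -> goldman f.
Proof.
elim: s R f => [|y s IH] R f gf; last exact: goldman_eval (IH _ _ (generated_eval gf)).
exists 1; rewrite rmorph1 oner_neq0; split=> // c /invL[w wc].
have [b fb] := generated_nil gf w.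
by exists 1%N, b; rewrite fb mulrC wc expr1.
Qed.

(** Zariski's lemma: [s] also generates [L] over [K[y]], so [K[y]] becomes a field after inverting
    one element, which excludes that [y] is transcendental. *)
Lemma generated_algebraic (K : fieldType) (f : {rmorphism K -> L}) s y :
  generated f s -> exists2 p, p \is monic & eval_morph f y p = 0.
Proof.
move=> gf; have gfy : generated (eval_morph f y) s.
  by move=> B subB fB sB; apply: gf => // x; rewrite -(eval_morphC f y).
have [p [p0 py]] := goldman_algebraic (generated_goldman gfy).
have lp : lead_coef p != 0 by rewrite lead_coef_eq0; apply: contraNneq p0 => ->; rewrite rmorph0.
exists ((lead_coef p)^-1 *: p); first by rewrite monicE lead_coefZ mulVf.
by rewrite -mul_polyC rmorphM /= py mulr0.
Qed.

End Nullstellensatz.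

(** * Prime ideals and regular sequences *)

Section Primes.
Variable R : comNzRingType.
Implicit Types (I J P Q S : R -> Prop) (a b : seq R) (t x y : R).

Definition is_prime P : Prop :=
  [/\ is_ideal P, ~ P 1 & forall x y, P (x * y) -> P x \/ P y].

(** An ideal [A] over [I] that is maximal among those disjoint from [S] is prime: if [x] and [y] are
    not in [A], then [A + (x)] and [A + (y)] meet [S], and the product of the elements found lies in
    [A + (x * y)]. *)
Lemma prime_avoiding I S : is_ideal I -> S 1 ->
  (forall x y, S x -> S y -> S (x * y)) -> (forall x, S x -> ~ I x) ->
  exists Q, [/\ is_prime Q, forall x, I x -> Q x & forall x, S x -> ~ Q x].
Proof.
move=> idI S1 SM SI.
pose good J := [/\ is_ideal J, forall x, I x -> J x & forall x, S x -> ~ J x].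
(* Zorn's lemma quantifies over all chains, including the empty one. *)
pose admissible J := (forall x, ~ J x) \/ good J.
have [F FP Ftot|A [PA Amax]] := @classical_sets.Zorn_bigcup R admissible.
  have [[J [FJ [x Jx]]]|Fempty] := pselect (exists J, F J /\ exists x, J x); last first.
    by left=> x [J FJ Jx]; apply: Fempty; exists J; split=> //; exists x.
  have Fgood X y : F X -> X y -> good X by move=> /FP[Xe /Xe|].
  right; split; first split.
  - by exists J => //; have [idJ _ _] := Fgood _ _ FJ Jx; apply: ideal0 idJ.
  - move=> c y z [X FX Xy] [Y FY Yz]; have [idX _ _] := Fgood _ _ FX Xy.
    have [idY _ _] := Fgood _ _ FY Yz; have [sXY|sYX] := Ftot _ _ FX FY.
      by exists Y => //; apply: idY.2 => //; apply: sXY.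
    by exists X => //; apply: idX.2 => //; apply: sYX.
  - by move=> y Iy; exists J => //; have [_ IJ _] := Fgood _ _ FJ Jx; apply: IJ.
  - by move=> y Sy [X FX Xy]; have [_ _ /(_ y Sy)] := Fgood _ _ FX Xy.
have [idA IA SA] : good A.
  case: PA => // Ae; case: (Amax I); last by right; split.
  by split=> [x /Ae//|/(_ 0 (ideal0 idI)) /Ae].
exists A; split=> //; split=> // [|x y Axy]; first exact: (SA 1 S1).
apply: contrapT => /not_orP[nAx nAy].
have bigger z : ~ A z -> exists2 s, S s & adjoin A z s.
  move=> nAz; apply: contrapT => none; apply: (Amax (adjoin A z)).
    split=> [u Au|sub]; first exact: adjoin_sub _ Au.
    by apply: nAz; apply: sub; apply: adjoin_self.
  right; split; first exact: adjoin_ideal.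
    by move=> u /IA; apply: adjoin_sub.
  by move=> u Su Au; apply: none; exists u.
have [s Ss [c sc]] := bigger x nAx; have [r Sr [d rd]] := bigger y nAy.
apply: (SA _ (SM _ _ Ss Sr)).
rewrite (_ : s * r = r * (s - c * x) + (c * x * (r - d * y) + c * d * (x * y))).
  by apply: idA.2 => //; apply: idA.2 => //; apply: idealMl.
by ring.
Qed.

Definition nzd I t : Prop := forall x, I (t * x) -> I x.

(** Properness of the ideal is not asked for: in a localization, the prime of a facet may extend to
    the unit ideal. *)
Fixpoint weakly_regular I a : Prop :=
  if a is t :: b then nzd I t /\ weakly_regular (adjoin I t) b else True.

Lemma weakly_regular_rcons I a t :
  weakly_regular I (rcons a t) <-> weakly_regular I a /\ nzd (adjoins I a) t.
Proof.
elim: a I => [|u a IH] I /=; first by split=> [[]|[]].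
by rewrite IH; split=> [[? [? ?]]|[[? ?] ?]].
Qed.

Lemma nzd_ext I J t : (forall x, I x <-> J x) -> nzd I t <-> nzd J t.
Proof. by move=> IJ; split=> n x /IJ/n/IJ. Qed.

Lemma weakly_regularP a : weakly_regular (fun x => x = 0) a <->
  forall i x, (i < size a)%N ->
    ideal_span (take i a) (a`_i * x) -> ideal_span (take i a) x.
Proof.
elim/last_ind: a => [|a t IH]; first by split.
rewrite weakly_regular_rcons IH -(nzd_ext t (ideal_spanE a)) size_rcons.
split=> [[aP tP] i x|h].
  rewrite ltnS leq_eqVlt => /predU1P[->|ia].
    by rewrite nth_rcons ltnn eqxx -cats1 take_size_cat //; apply: tP.
  by rewrite nth_rcons ia -cats1 takel_cat ?(ltnW ia) //; apply: aP.
split=> [i x ia|x]; last first.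
  by have := h (size a) x; rewrite nth_rcons ltnn eqxx -cats1 take_size_cat //; apply.
have := h i x; rewrite nth_rcons ia -cats1 takel_cat ?(ltnW ia) //; apply.
by rewrite ltnS ltnW.
Qed.

Definition chain_of_primes k (Q : nat -> R -> Prop) : Prop :=
  (forall i, (i <= k)%N -> is_prime (Q i)) /\
  forall i, (i < k)%N ->
    (forall x, Q i x -> Q i.+1 x) /\ exists x, Q i.+1 x /\ ~ Q i x.

Lemma chain_of_primesP k : (exists Q : nat -> R -> Prop, chain_of_primes k Q) <->
  exists P : 'I_k.+1 -> {pred R}, prime_chain P.
Proof.
split=> [[Q [Qprime Qstrict]]|[P [Pprime Pstrict]]].
  have Qsub i j x : (i <= j <= k)%N -> Q i x -> Q j x.
    case/andP; move/subnKC <-; elim: (j - i)%N => [|m IH]; first by rewrite addn0.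
    by rewrite addnS => mk Qx; apply: (Qstrict _ mk).1; apply: IH (ltnW mk) Qx.
  exists (fun i x => `[< Q i x >]); split=> [i|i j ij].
    have [idQ Q1 QM] := Qprime i (ltn_ord i); split; first split.
    - exact/asboolP/(ideal0 idQ).
    - by apply/negP => /asboolP.
    - by move=> c x y /asboolP Qx /asboolP Qy; apply/asboolP/idQ.2.
    move=> x y /asboolP/QM[] ?; apply/orP; [left|right]; exact/asboolP.
  have [_ [x [Qx nQx]]] := Qstrict i (leq_trans ij (ltn_ord j)).
  have jk : (j <= k)%N by exact: ltn_ord j.
  split=> [y /asboolP Qy|sub]; first by apply/asboolP/(Qsub i); rewrite ?(ltnW ij).
  by apply/nQx/asboolP/sub/asboolP/(Qsub i.+1); rewrite ?ij.
exists (fun i x => x \in P (inord i)); split=> [i ik|i ik].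
  have [[P0 P1 PD] PM] := Pprime (inord i); split; first by split.
    exact/negP.
  by move=> x y /PM/orP.
have [|sub nsub] := Pstrict (inord i) (inord i.+1).
  by rewrite !inordK // ltnS ltnW.
split=> [x|]; first exact: sub.
apply: contrapT => none; apply: nsub => x Px; apply: contrapT => nPx.
by apply: none; exists x.
Qed.

(* A minimal prime over [I] consists of zero divisors modulo [I]. *)
Lemma prime_below I P t : is_ideal I -> is_prime P ->
  (forall x, I x -> P x) -> P t -> nzd I t ->
  exists Q, [/\ is_prime Q, forall x, I x -> Q x, forall x, Q x -> P x & ~ Q t].
Proof.
move=> idI [idP P1 PM] IP Pt nt.
pose S x := exists s n, ~ P s /\ x = s * t ^+ n.
have [|||Q [Qpr IQ SQ]] := @prime_avoiding I S idI.
- by exists 1, 0%N; rewrite mulr1.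
- move=> _ _ [s [m [Ps ->]]] [r [n [Pr ->]]]; exists (s * r), (m + n)%N.
  by split; [case/PM|rewrite exprD; ring].
- move=> _ [s [n [Ps ->]]] Ist; apply/Ps/IP.
  elim: n Ist => [|n IH]; first by rewrite mulr1.
  by rewrite exprS mulrCA => /nt/IH.
exists Q; split=> // [x Qx|]; last by apply: SQ; exists 1, 1%N; rewrite mul1r.
by apply: contrapT => Px; apply: SQ Qx; exists x, 0%N; rewrite mulr1.
Qed.

(** The chain is built downwards from [P]. The last element [t] is regular modulo its predecessors,
    so below [P] there is a prime that contains these but not [t]. *)
Lemma weakly_regular_chain I P a : is_ideal I -> weakly_regular I a ->
  is_prime P -> (forall x, adjoins I a x -> P x) ->
  exists2 Q, chain_of_primes (size a) Q & Q (size a) = P.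
Proof.
move=> idI; elim/last_ind: a P => [|a t IH] P.
  by move=> _ Ppr _; exists (fun=> P) => //; split.
move=> /weakly_regular_rcons[ra nt] Ppr; rewrite adjoins_rcons => aP.
have idIa := adjoins_ideal a idI.
have Pt : P t by apply/aP/adjoin_self.
have [|Q0 [Q0pr aQ0 Q0P Q0t]] := prime_below idIa Ppr _ Pt nt.
  by move=> x Ix; apply/aP/adjoin_sub.
have [Q [Qpr Qst] Qa] := IH Q0 ra Q0pr aQ0.
exists (fun i => if (i <= size a)%N then Q i else P); rewrite size_rcons ?ltnn //.
split=> i; first by case: ifP => // ia _; apply: Qpr.
rewrite ltnS [X in is_true X -> _]leq_eqVlt => /predU1P[->|ia]; last first.
  by rewrite /= ia (ltnW ia); apply: Qst.
by rewrite /= leqnn ltnn Qa; split=> //; exists t.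
Qed.

(** This bounds the depth by the Krull dimension. The chain descends from any prime over the proper
    ideal spanned by [a]. *)
Lemma regular_sequence_chain a : regular_sequence a ->
  exists P : 'I_(size a).+1 -> {pred R}, prime_chain P.
Proof.
case=> /weakly_regularP ra a1; apply/chain_of_primesP.
have [||||P [Ppr aP _]] := @prime_avoiding (ideal_span a) (fun x => x = 1).
- exact: ideal_span_ideal.
- by [].
- by move=> x y -> ->; rewrite mulr1.
- by move=> x ->.
have [|Q Qch _] := weakly_regular_chain (is_ideal0 R) ra Ppr; last by exists Q.
by move=> x /ideal_spanE/aP.
Qed.

End Primes.

(** * Permuting regular sequences in local rings *)

Section Regular.
Variable R : comNzRingType.
Implicit Types (I J C : R -> Prop) (a b s : seq R) (t x y z : R).

Lemma adjoin_ext I J t : (forall x, I x <-> J x) ->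
  forall x, adjoin I t x <-> adjoin J t x.
Proof. by move=> IJ x; split; apply: adjoin_mono => z /IJ. Qed.

Lemma adjoinC I t y x : adjoin (adjoin I t) y x -> adjoin (adjoin I y) t x.
Proof. by case=> c [d h]; exists d, c; rewrite addrAC. Qed.

Lemma weakly_regular_ext I J a :
  (forall x, I x <-> J x) -> weakly_regular I a -> weakly_regular J a.
Proof.
elim: a I J => //= t a IH I J IJ [nt ra]; split; first exact/(nzd_ext t IJ).
exact: IH (adjoin_ext t IJ) ra.
Qed.

Lemma weakly_regular_cong (T : eqType) I (f g : T -> R) (s : seq T) : is_ideal I ->
  (forall k, k \in s -> I (f k - g k)) ->
  weakly_regular I (map f s) -> weakly_regular I (map g s).
Proof.
elim: s I => //= k s IH I idI fg [nf rf].
have Ik := fg k (mem_head _ _); split=> [z gz|].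
  apply/nf/(ideal_cong idI (y := g k * z)) => //.
  by rewrite -mulrBl; apply: idealMr.
apply: IH (adjoin_ideal _ idI) _ _ => [j js|].
  by apply/adjoin_sub/fg; rewrite inE js orbT.
apply: weakly_regular_ext rf => x; split=> -[c h]; exists c.
  rewrite -(subrK (x - c * f k) (x - c * g k)); apply: idealD => //.
  by rewrite (_ : _ - _ = c * (f k - g k)); [apply: idealMl|ring].
rewrite -(subrK (x - c * g k) (x - c * f k)); apply: idealD => //.
by rewrite (_ : _ - _ = - c * (f k - g k)); [apply: idealMl|ring].
Qed.

(* The exact sequence [0 -> R/(I : r) -> R/I -> R/(I + r) -> 0]. *)
Lemma weakly_regular_colon I J C t a : is_ideal I ->
  (forall z, J z <-> adjoin I t z) -> (forall z, C z <-> I (t * z)) ->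
  weakly_regular J a -> weakly_regular C a -> weakly_regular I a.
Proof.
elim: a I J C => //= y a IH I J C idI JE CE [nJ rJ] [nC rC]; split.
  move=> z Iyz; have /nJ/JE[w Iw] : J (y * z) by apply/JE/adjoin_sub.
  rewrite -(subrK (w * t) z); apply: idealD => //; rewrite mulrC; apply/CE/nC/CE.
  rewrite (_ : _ * _ = y * z - y * (z - w * t)); last by ring.
  by apply: idealB => //; apply: idealMl.
apply: IH rJ rC; first exact: adjoin_ideal.
  move=> z; rewrite (adjoin_ext y JE); split; exact: adjoinC.
(* It remains to see that [(I + (y)) : t] is [C + (y)]. If [t * z - c * y] is in [I], then [y * c]
   is in [J], so [c] is in [J = I + (t)] by regularity of [y], and a multiple of [y] corrects [z] to
   an element of [C]. *)
move=> z; split=> [[c /CE h]|[c h]].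
  by exists (t * c); rewrite -mulrA -mulrBr.
have /nJ/JE[w Iw] : J (y * c).
  apply/JE; exists z; rewrite (_ : _ - _ = - (t * z - c * y)); last by ring.
  exact: idealN.
exists w; apply/CE; rewrite (_ : t * _ = t * z - c * y + y * (c - w * t)).
  by apply: idealD => //; apply: idealMl.
by ring.
Qed.

Definition jacobson x : Prop := forall c, exists u, u * (1 - c * x) = 1.

Lemma ideal_span_cons t b z : ideal_span (t :: b) z -> exists c, ideal_span b (z - c * t).
Proof.
case/ideal_spanP=> c ->; exists (c 0%N); apply/ideal_spanP; exists (fun i => c i.+1).
by rewrite big_ord_recl /= addrC addKr.
Qed.

(** Generators are eliminated one at a time: modulo [J], [t] is [x] times a combination of [t] and
    [b], and since [1 - c * x] is a unit, this can be solved for [t]. *)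
Lemma nakayama J x b : is_ideal J -> jacobson x ->
  (forall z, z \in b -> exists2 w, ideal_span b w & J (z - x * w)) ->
  forall z, z \in b -> J z.
Proof.
move=> idJ jx; elim: b => // t b IH hb.
have idb := ideal_span_ideal b.
have [w /ideal_span_cons[c bw] Jw] := hb t (mem_head _ _).
have [u ux] := jx c.
pose s := u * (w - c * t).
have bs : ideal_span b s by apply: idealMl.
have Jt : J (t - x * s).
  rewrite (_ : t - x * s = u * (t - x * w)); first exact: idealMl.
  rewrite -[X in X - _ = _]mul1r -ux /s; ring.
have Jb z : z \in b -> J z.
  apply: IH => y yb; have [|v /ideal_span_cons[d bv] Jv] := hb y.
    by rewrite inE yb orbT.
  exists (v - d * t + d * (x * s)); first by apply: idealD => //; do 2!apply: (idealMl idb).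
  rewrite (_ : y - _ = (y - x * v) + x * d * (t - x * s)); last by ring.
  by apply: idealD => //; apply: idealMl.
move=> z; rewrite inE => /predU1P[->|/Jb //].
rewrite -(subrK (x * s) t); apply: idealD => //; apply: idealMl => //.
exact: ideal_span_sub bs.
Qed.

Hypothesis noethR : noetherian R.

(** The ideal [H = (I : t)] satisfies [H = I + y * H]: an element of [H] is in [I + (y)] by
    regularity of [t], and its cofactor of [y] is again in [H] by regularity of [y]. Nakayama then
    gives [H = I]. *)
Lemma nzd_swap I y t : is_ideal I -> jacobson y ->
  nzd I y -> nzd (adjoin I y) t -> nzd I t /\ nzd (adjoin I t) y.
Proof.
move=> idI jy ny nt; have nIt : nzd I t.
  pose H z := I (t * z).
  have idH : is_ideal H.
    split; first by rewrite /H mulr0; apply: ideal0.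
    by move=> c x z Hx Hz; rewrite /H mulrDr mulrCA; apply: idI.2.
  have [b bP] := (noetherianP R).1 noethR H idH.
  move=> x /bP; apply: ideal_span_sub => //.
  apply: (nakayama idI jy) => z /ideal_span_mem/bP Hz.
  have [c Ic] := nt z (adjoin_sub y (Hz : I (t * z))).
  exists c; last by rewrite mulrC.
  apply/bP/ny; rewrite (_ : y * _ = t * z - t * (z - c * y)); last by ring.
  by apply: idealB => //; apply: idealMl.
split=> // x [c Ic].
have [|w Iw] := nt c.
  exists x; rewrite (_ : _ - _ = - (y * x - c * t)); last by ring.
  exact: idealN.
exists w; apply: ny; rewrite (_ : _ * _ = (y * x - c * t) + t * (c - w * y)).
  by apply: idealD => //; apply: idealMl.
by ring.
Qed.

Lemma weakly_regular_move_last I y a : is_ideal I -> jacobson y ->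
  weakly_regular I (y :: a) -> weakly_regular I (rcons a y).
Proof.
elim: a I => [|t a IH] I idI jy //= [ny [nt ra]].
have [nIt nIy] := nzd_swap idI jy ny nt; split=> //.
apply: IH (adjoin_ideal _ idI) jy _; split=> //.
by apply: weakly_regular_ext ra => x; split; apply: adjoinC.
Qed.

(** The elementary symmetric polynomial is read off the generating polynomial, so that symmetry and
    the recursion in [s] come from the product. *)
Definition esym s k : R := (\prod_(y <- s) (1 + y%:P * 'X))`_k.

Lemma esym0 s : esym s 0 = 1.
Proof.
rewrite /esym -horner_coef0 horner_prod big1 // => y _.
by rewrite hornerD hornerM hornerX mulr0 hornerC addr0.
Qed.

Lemma esym_consS y s k : esym (y :: s) k.+1 = esym s k.+1 + y * esym s k.
Proof. by rewrite /esym big_cons mulrDl mul1r coefD -mulrA coefCM coefXM. Qed.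

Lemma perm_esym s s' : perm_eq s s' -> esym s =1 esym s'.
Proof. by move=> ss' k; rewrite /esym (perm_big _ ss'). Qed.

Lemma esym_gt s k : (size s < k)%N -> esym s k = 0.
Proof.
elim: s k => [|y s IH] [|k] //= sk; first by rewrite /esym big_nil coef1.
by rewrite esym_consS !IH ?mulr0 ?addr0 // ltnW.
Qed.

Lemma esym_size s : esym s (size s) = \prod_(y <- s) y.
Proof.
elim: s => [|y s IH]; first by rewrite esym0 big_nil.
by rewrite big_cons esym_consS esym_gt // add0r IH.
Qed.

Definition esyms s d := [seq esym s k | k <- iota 1 d].

Lemma esym_cong I y s k : is_ideal I -> I y -> I (esym (y :: s) k - esym s k).
Proof.
move=> idI Iy; case: k => [|k]; first by rewrite !esym0 subrr; apply: ideal0.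
by rewrite esym_consS addrC addKr; apply: idealMr.
Qed.

Lemma esym_cong_cat I s s' k : is_ideal I -> (forall y, y \in s -> I y) ->
  I (esym (s ++ s') k - esym s' k).
Proof.
move=> idI; elim: s => [|y s IH] sI; first by rewrite subrr; apply: ideal0.
rewrite -(subrK (esym (s ++ s') k) (esym _ _)) -addrA; apply: idealD => //.
  by apply: esym_cong => //; apply/sI/mem_head.
by apply: IH => z zs; apply: sI; rewrite inE zs orbT.
Qed.

Lemma esym_ideal I s k : is_ideal I -> (forall y, y \in s -> I y) -> I (esym s k.+1).
Proof.
move=> idI sI; have := esym_cong_cat [::] k.+1 idI sI.
by rewrite cats0 [esym [::] _]/esym big_nil coef1 subr0.
Qed.

(* Modulo any [y] in [s], the first [d - 1] elementary symmetric polynomials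
   in [s] are those in the remaining elements, so they form a regular sequence
   after which [y] can be moved; the last one is the product of all these [y]. *)
Lemma weakly_regular_esym (T : eqType) (f : T -> R) I (s : seq T) d :
  is_ideal I -> size s = d -> (forall y : T, y \in s -> jacobson (f y)) ->
  (forall s' : seq T, perm_eq s s' -> weakly_regular I (map f s')) ->
  weakly_regular I (esyms (map f s) d).
Proof.
move=> idI; elim: d s I idI => // d IH s I idI ss js rs.
have main (y : T) : y \in s -> weakly_regular I (rcons (esyms (map f s) d) (f y)).
  move=> ys; apply: weakly_regular_move_last => //; first exact: js.
  have ps := perm_to_rem ys; have [ny _] := rs _ ps; split=> //.
  have idIy := adjoin_ideal (f y) idI.
  apply: (weakly_regular_cong (f := esym (map f (rem y s)))) => // [k _|].
    rewrite -opprB (perm_esym (perm_map f ps)); apply: (idealN idIy).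
    by apply: (esym_cong _ _ idIy); apply: adjoin_self.
  apply: IH => //; first by rewrite size_rem // ss.
    by move=> z /mem_rem/js.
  move=> s' ss'; have [] // := rs (y :: s') _.
  by rewrite (perm_trans ps) // perm_cons.
rewrite /esyms -[d.+1]addn1 iotaD map_cat cats1; apply/weakly_regular_rcons.
split.
  case: s ss main {js rs} => // y s _ /(_ y (mem_head _ _)).
  by case/weakly_regular_rcons.
rewrite add1n -ss -(size_map f) esym_size big_map big_seq.
apply: (big_ind (nzd (adjoins I (esyms (map f s) d)))).
- by move=> x; rewrite mul1r.
- by move=> x y nx ny z; rewrite -mulrA => /nx/ny.
- by move=> y /main/weakly_regular_rcons[].
Qed.

End Regular.

(** * Monomial ideals of shellings *)

Section MonomialIdeals.
Variables (K : fieldType) (V : finType).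
Notation n := #|V|.
Notation S := {mpoly K[n]}.
Implicit Types (m : 'X_{1..n}) (F G : {set V}) (fs : seq {set V}) (z : S).

Definition supp m : {set V} := [set v | m (enum_rank v) != 0%N].

Lemma suppD m1 m2 : supp (m1 + m2)%MM = supp m1 :|: supp m2.
Proof. by apply/setP => v; rewrite !inE mnmDE addn_eq0 negb_and. Qed.

Definition sqfree_mnm F : 'X_{1..n} := [multinom ((enum_val i \in F) : nat) | i < n].

Lemma supp_sqfree_mnm F : supp (sqfree_mnm F) = F.
Proof. by apply/setP => v; rewrite inE mnmE enum_rankK eqb0 negbK. Qed.

Lemma sqfree_monomialE F : sqfree_monomial K F = 'X_[sqfree_mnm F].
Proof.
rewrite /sqfree_monomial mprodXE; congr 'X_[_]; apply/mnmP => i.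
rewrite mnm_sumE mnmE; have [iF|iF] := boolP (enum_val i \in F).
  rewrite (bigD1 (enum_val i)) //= mnm1E enum_valK eqxx big1 // => v /andP[_ ne].
  by rewrite mnm1E; case: eqP => // e; rewrite -e enum_rankK eqxx in ne.
rewrite big1 // => v vF; rewrite mnm1E; case: eqP => // e.
by rewrite -e enum_rankK vF in iF.
Qed.

Lemma sqfree_mnm_dvd F m : F \subset supp m -> exists m', m = (m' + sqfree_mnm F)%MM.
Proof.
move=> /subsetP sF; exists (m - sqfree_mnm F)%MM; rewrite submK //.
apply/mnm_lepP => i; rewrite mnmE; case: (boolP (_ \in F)) => // /sF.
by rewrite inE enum_valK lt0n.
Qed.

(** Described by monomials, this is the Stanley-Reisner ideal of the complex generated by [fs]. For
    a single [F] it is the prime [P_F]; for the empty list it is the whole ring. *)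
Definition nonface_ideal fs : S -> Prop :=
  fun z => forall m, m \in msupp z -> forall F, F \in fs -> ~~ (supp m \subset F).

Lemma nonface_idealP fs : is_ideal (nonface_ideal fs).
Proof.
split=> [m|c x y Ix Iy m /msuppD_le]; first by rewrite msupp0.
rewrite mem_cat => /orP[/msuppM_le/allpairsP[[m1 m2] /= [_ m2x ->]] F Ffs|/Iy //].
by apply: contra (Ix _ m2x _ Ffs); rewrite suppD; apply/subset_trans/subsetUr.
Qed.

Lemma nonface_ideal_term fs (c : K) m :
  (forall F, F \in fs -> ~~ (supp m \subset F)) -> nonface_ideal fs (c *: 'X_[m]).
Proof. by move=> h _ /msuppZ_le/mem_msuppXP <-. Qed.

Lemma nonface_ideal_gen (J : S -> Prop) F : is_ideal J ->
  (forall v, v \notin F -> J 'X_(enum_rank v)) ->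
  forall z, nonface_ideal [:: F] z -> J z.
Proof.
move=> idJ JX z zF; rewrite [z]mpolyE big_seq.
apply: ideal_sum => // m /zF/(_ F (mem_head _ _))/subsetPn[v].
rewrite inE => mv vF; rewrite -mul_mpolyC; apply: idealMl => //.
have /sqfree_mnm_dvd[m' ->] : [set v] \subset supp m by rewrite sub1set inE.
rewrite mpolyXD -sqfree_monomialE /sqfree_monomial big_set1.
exact/(idealMl idJ)/JX.
Qed.

Definition shelling fs : Prop := forall i j, (i < j < size fs)%N ->
  exists2 v, v \in nth set0 fs j :\: nth set0 fs i &
    exists2 l, (l < j)%N & nth set0 fs j :\: nth set0 fs l = [set v].

Lemma shelling_rcons fs F : shelling (rcons fs F) ->
  shelling fs /\ forall G, G \in fs ->
    exists2 v, v \in F :\: G & exists2 L, L \in fs & F :\: L = [set v].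
Proof.
move=> sh; split=> [i j /andP[ij jfs]|G /(nthP set0)[i ifs <-]].
  have [|v] := sh i j; first by rewrite ij size_rcons ltnS ltnW.
  rewrite !nth_rcons jfs (ltn_trans ij jfs) => vj [l lj].
  by rewrite nth_rcons (ltn_trans lj jfs) => e; exists v => //; exists l.
have [|v] := sh i (size fs); first by rewrite ifs size_rcons leqnn.
rewrite !nth_rcons ltnn eqxx ifs => vF [l lfs].
rewrite nth_rcons lfs => e; exists v => //; exists (nth set0 fs l) => //.
exact: mem_nth.
Qed.

(** These are the [v] in [F] such that [F] without [v] lies in an earlier facet. In a shelling they
    form the least face of [F] that lies in no earlier facet. *)
Definition restriction fs F : {set V} :=
  [set v in F | has (fun L => F :\: L == [set v]) fs].

Section Step.
Variables (fs : seq {set V}) (F : {set V}).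
Hypothesis shF : forall G, G \in fs ->
  exists2 v, v \in F :\: G & exists2 L, L \in fs & F :\: L = [set v].

Lemma restriction_sub G : G \in fs -> ~~ (restriction fs F \subset G).
Proof.
move=> /shF[v /setDP[vF vG] [L Lfs FL]]; apply/subsetPn; exists v => //.
by rewrite inE vF; apply/hasP; exists L; rewrite ?FL.
Qed.

Lemma restriction_subr : restriction fs F \subset F.
Proof. by apply/subsetP => v /setIdP[]. Qed.

Lemma nonface_ideal_colon z :
  nonface_ideal [:: F] z <-> nonface_ideal (rcons fs F) ('X_[sqfree_mnm (restriction fs F)] * z).
Proof.
set r := sqfree_mnm _; rewrite mulrC; split=> zI m.
  rewrite (perm_mem (msuppMX z r)) => /mapP[m' m'z ->] G.
  rewrite suppD supp_sqfree_mnm mem_rcons inE subUset.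
  case/predU1P=> [->|/restriction_sub]; last by apply: contra => /andP[].
  by apply: contra (zI _ m'z F (mem_head _ _)) => /andP[].
move=> mz G; rewrite inE => /eqP->; have := zI (r + m)%MM _ F.
rewrite mem_rcons mem_head suppD supp_sqfree_mnm subUset restriction_subr; apply=> //.
by rewrite (perm_mem (msuppMX z r)); apply: map_f.
Qed.

(** A monomial supported in [F] but in no earlier facet is divisible by that of the restriction: its
    support is not in [L], so it meets [F :\: L], which is a single vertex [v]. *)
Lemma nonface_ideal_adjoin z :
  nonface_ideal fs z <-> adjoin (nonface_ideal (rcons fs F)) 'X_[sqfree_mnm (restriction fs F)] z.
Proof.
set r := sqfree_mnm _; have idI := nonface_idealP fs.
have sub y : nonface_ideal (rcons fs F) y -> nonface_ideal fs y.
  by move=> yI m /yI h G Gfs; apply: h; rewrite mem_rcons inE Gfs orbT.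
split=> [zI|[c /sub h]]; last first.
  rewrite -(subrK (c * 'X_[r]) z); apply: (idealD idI) => //; apply: (idealMl idI).
  rewrite -['X_[r]]scale1r; apply: nonface_ideal_term => G Gfs.
  by rewrite supp_sqfree_mnm restriction_sub.
have idA := adjoin_ideal 'X_[r] (nonface_idealP (rcons fs F)).
rewrite [z]mpolyE big_seq; apply: ideal_sum => // m mz.
have [mF|mF] := boolP (supp m \subset F); last first.
  apply/adjoin_sub/nonface_ideal_term => G; rewrite mem_rcons inE.
  by case/predU1P=> [-> //|]; apply: zI.
have /sqfree_mnm_dvd[m' ->] : restriction fs F \subset supp m.
  apply/subsetP => v; rewrite inE => /andP[vF /hasP[L Lfs /eqP FL]].
  have /subsetPn[w wm wL] := zI _ mz _ Lfs.
  have : w \in F :\: L by rewrite inE wL (subsetP mF).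
  by rewrite FL inE => /eqP <-.
rewrite mpolyXD scalerAl; exact: adjoin_gen (nonface_idealP _).
Qed.

End Step.

Lemma SR_idealE (D : scomplex V) fs : fs =i facets D ->
  forall z, z \in @SR_ideal K V D <-> nonface_ideal fs z.
Proof.
move=> fsD z; have nface m : (forall F, F \in fs -> ~~ (supp m \subset F)) <-> supp m \notin D.
  split=> [h|mD F].
    apply/negP => mD; have [F Fmax mF] := maxset_exists (mD : (mem (faces D)) (supp m)).
    by have := h F; rewrite fsD inE Fmax mF => /(_ isT).
  rewrite fsD inE => /maxsetP[FD _]; apply: contra mD => mF.
  exact: facesS mF FD.
split=> [/asboolP[c ->]|zI].
  apply: ideal_sum => [|F FD]; first exact: nonface_idealP.
  apply: (idealMl (nonface_idealP _)); rewrite sqfree_monomialE -['X_[_]]scale1r.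
  by apply/nonface_ideal_term/nface; rewrite supp_sqfree_mnm.
rewrite [z]mpolyE big_seq; apply: rpred_sum => m /zI/nface mD.
have /sqfree_mnm_dvd[m' ->] := subxx (supp m).
rewrite mpolyXD -sqfree_monomialE scalerAl ring_quotient.idealMr //; apply/asboolP.
exists (fun F => (F == supp m)%:R); rewrite (bigD1 (supp m)) //= eqxx mul1r.
by rewrite big1 ?addr0 // => F /andP[_ /negPf->]; rewrite mul0r.
Qed.

End MonomialIdeals.

(** * Regularity of univariate polynomials in distinct variables *)

(** Descending induction on [k]: if [p] has degree [d], the coefficient of [p * f] at [d + k] is
    that of [f] at [k] plus multiples of higher coefficients of [f]. *)
Lemma monic_mul_ideal (R : comNzRingType) (I : R -> Prop) (p f : {poly R}) :
  is_ideal I -> p \is monic -> (forall k, I (p * f)`_k) -> forall k, I f`_k.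
Proof.
move=> idI mp pf; suff: forall j k, (size f <= k + j)%N -> I f`_k.
  by move=> h k; apply: (h (size f)); rewrite leq_addl.
elim=> [|j IH] k; first by rewrite addn0 => /(nth_default 0) ->; apply: ideal0.
rewrite addnS => skj; have [d sd] : exists d, size p = d.+1.
  by exists (size p).-1; rewrite prednK // size_poly_gt0 monic_neq0.
have pd : p`_d = 1 by rewrite -(monicP mp) lead_coefE sd.
have := pf (d + k)%N; rewrite coefM.
have dk : (d < (d + k).+1)%N by rewrite ltnS leq_addr.
rewrite (bigD1 (Ordinal dk)) //= pd mul1r addKn => Isum.
pose s := \sum_(i < (d + k).+1 | i != Ordinal dk) p`_i * f`_(d + k - i).
rewrite -[f`_k](addrK s); apply: (idealB idI) => //.
apply: (ideal_sum idI) => i ine; have [id|di] := ltnP i d.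
  apply: (idealMl idI); apply: IH; move: skj id; clear; lia.
rewrite [p`_i]nth_default ?mul0r; first exact: ideal0.
rewrite sd ltn_neqAle di andbT; apply: contraNneq ine => e.
by apply/eqP/val_inj.
Qed.

Section Variables.
Variables (K : fieldType) (V : finType).
Notation n := #|V|.
Notation S := {mpoly K[n]}.
Implicit Types (F : {set V}) (v w : V) (I : S -> Prop) (p : {poly K}).

Definition var v : S := 'X_(enum_rank v).

(* [isolate v z] is [z] as a univariate polynomial in the variable [v]. *)
Definition isolate v : S -> {poly S} :=
  mmap (polyC \o (@mpolyC n K))
    (fun i => if i == enum_rank v then 'X else ('X_i : S)%:P).

HB.instance Definition _ v := GRing.RMorphism.on (isolate v).

Lemma isolateC v c : isolate v c%:MP = (c%:MP)%:P.
Proof. exact: mmapC. Qed.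

Lemma isolate_var v w :
  isolate v (var w) = if w == v then 'X else (var w)%:P.
Proof.
by rewrite /isolate /var mmapX mmap1U (can_eq enum_rankK).
Qed.

Lemma isolate_term v m :
  (isolate v 'X_[m]).[var v] = 'X_[m].
Proof.
rewrite /isolate mmapX horner_prod mpolyXE_id; apply: eq_bigr => i _.
by rewrite horner_exp; case: eqP => [->|_]; rewrite ?hornerX ?hornerC.
Qed.

Lemma isolateK v z : (isolate v z).[var v] = z.
Proof.
rewrite [in LHS](mpolyE z) rmorph_sum horner_sum [RHS]mpolyE; apply: eq_bigr => m _.
by rewrite -!mul_mpolyC rmorphM /= hornerM isolateC hornerC isolate_term.
Qed.

(** Such an ideal is extended from the polynomial ring in the other variables, so the quotient is a
    polynomial ring in [v], where monic polynomials are regular. *)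
Definition stable v I : Prop := forall z, I z -> forall k, I (isolate v z)`_k.

Definition peval p v : S := (map_poly (@mpolyC n K) p).[var v].

Lemma isolate_peval v p :
  isolate v (peval p v) = map_poly (@mpolyC n K) p.
Proof.
rewrite /peval -horner_map /= isolate_var eqxx -map_poly_comp.
rewrite (eq_map_poly (g := polyC \o @mpolyC n K)); last exact: isolateC.
by rewrite map_poly_comp /= -[RHS]comp_polyXr.
Qed.

Lemma isolate_peval_neq v w p : w != v -> isolate v (peval p w) = (peval p w)%:P.
Proof.
move=> wv; rewrite /peval -horner_map /= isolate_var (negPf wv) -map_poly_comp.
rewrite (eq_map_poly (g := polyC \o @mpolyC n K)); last exact: isolateC.
by rewrite map_poly_comp /= horner_map.
Qed.

Lemma stable_adjoin v I t : is_ideal I -> stable v I -> isolate v t = t%:P ->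
  stable v (adjoin I t).
Proof.
move=> idI stI vt z [c Ic] k; exists (isolate v c)`_k.
by have := stI _ Ic k; rewrite rmorphB rmorphM /= vt coefB coefMC.
Qed.

Lemma nzd_peval v I p : is_ideal I -> stable v I -> p \is monic -> nzd I (peval p v).
Proof.
move=> idI stI mp z Ipz; rewrite -(isolateK v z) horner_coef.
apply: (ideal_sum idI) => k _; apply: (idealMr idI).
apply: (monic_mul_ideal (p := map_poly (@mpolyC n K) p) idI); first exact: monic_map.
by move=> j; have := stI _ Ipz j; rewrite rmorphM /= isolate_peval.
Qed.

Lemma var_nonface F w : w \notin F -> nonface_ideal [:: F] (var w).
Proof.
move=> wF m /mem_msuppXP <- G; rewrite inE => /eqP->; apply: contra wF.
by move/subsetP; apply; rewrite inE mnm1E eqxx.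
Qed.

Lemma stable_nonface v F : v \in F -> stable v (@nonface_ideal K V [:: F]).
Proof.
move=> vF z zF k; have idI := @nonface_idealP K V [:: F].
pose J (y : S) := forall k, nonface_ideal [:: F] (isolate v y)`_k.
apply: (nonface_ideal_gen (J := J) (F := F)) zF k => [|w wF k].
  split=> [k|c x y Jx Jy k]; first by rewrite rmorph0 coef0; apply: ideal0.
  rewrite rmorphD rmorphM coefD; apply: (idealD idI); last exact: Jy.
  rewrite coefM; apply: (ideal_sum idI) => i _; apply: (idealMl idI).
  exact: Jx.
rewrite -/(var w) isolate_var; case: eqP => [e|_]; first by rewrite e vF in wF.
rewrite coefC; case: ifP => _; last exact: ideal0.
exact: var_nonface.
Qed.

(** Each polynomial involves only its own variable, so adjoining it keeps the ideal stable in the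
    remaining ones. *)
Lemma weakly_regular_peval (p : V -> {poly K}) I (s : seq V) : is_ideal I ->
  (forall v, p v \is monic) -> uniq s -> (forall v, v \in s -> stable v I) ->
  weakly_regular I [seq peval (p v) v | v <- s].
Proof.
move=> + mp; elim: s I => //= v s IH I idI /andP[vs us] st; split.
  by apply: nzd_peval => //; apply: st; apply: mem_head.
apply: IH => //; first exact: adjoin_ideal.
move=> w ws; apply: stable_adjoin => //; first by apply: st; rewrite inE ws orbT.
by apply: isolate_peval_neq; apply: contraNneq vs => ->.
Qed.

End Variables.

(** * Dimension of Stanley-Reisner rings *)

Section Dimension.
Variables (K : fieldType) (V : finType).
Notation n := #|V|.
Notation S := {mpoly K[n]}.
Implicit Types (F : {set V}) (z : S) (Q : nat -> S -> Prop).

(** Bounding every exponent instead of the total degree makes the number of possible monomials a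
    power with exponent [#|F|]. *)
Definition bounded F B z : Prop :=
  forall m, m \in msupp z -> supp m \subset F /\ forall i, (m i <= B)%N.

Lemma boundedW F B B' z : (B <= B')%N -> bounded F B z -> bounded F B' z.
Proof.
move=> BB zb m /zb[mF mB]; split=> // i; exact: leq_trans (mB i) BB.
Qed.

Lemma boundedD F B z1 z2 : bounded F B z1 -> bounded F B z2 -> bounded F B (z1 + z2).
Proof. by move=> b1 b2 m /msuppD_le; rewrite mem_cat => /orP[/b1|/b2]. Qed.

Lemma boundedC F c : bounded F 0 c%:MP.
Proof.
move=> m; rewrite msuppC; case: eqP => //= _; rewrite inE => /eqP->; split.
  by apply/subsetP => v; rewrite inE mnm0E.
by move=> i; rewrite mnm0E.
Qed.

Lemma boundedM F B1 B2 z1 z2 :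
  bounded F B1 z1 -> bounded F B2 z2 -> bounded F (B1 + B2) (z1 * z2).
Proof.
move=> b1 b2 m /msuppM_le/allpairsP[[m1 m2] /= [/b1[m1F m1B] /b2[m2F m2B] ->]].
by split=> [|i]; [rewrite suppD subUset m1F|rewrite mnmDE leq_add].
Qed.

Lemma boundedX F B z k : bounded F B z -> bounded F (k * B) (z ^+ k).
Proof.
move=> zb; elim: k => [|k IH]; first exact: boundedC.
by rewrite exprS mulSn; apply: boundedM.
Qed.

Lemma bounded_sum F B (I : Type) (r : seq I) (f : I -> S) :
  (forall i, bounded F B (f i)) -> bounded F B (\sum_(i <- r) f i).
Proof.
move=> fb; apply: big_ind => //; last exact: boundedD.
by have := boundedW (leq0n B) (@boundedC F 0); rewrite mpolyC0.
Qed.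

Definition truncate F z : S := \sum_(m <- msupp z | supp m \subset F) z@_m *: 'X_[m].

Lemma truncate_bounded F z : bounded F (msize z) (truncate F z).
Proof.
rewrite /truncate -big_filter => m /(msupp_sum_le (P := predT)).
rewrite filter_predT => /flattenP[s /mapP[m']].
rewrite mem_filter => /andP[m'F m'z] -> /msuppZ_le/mem_msuppXP <-; split=> // i.
apply: leq_trans (ltnW (msize_mdeg_lt m'z)); rewrite mdegE (bigD1 i) //=.
exact: leq_addr.
Qed.

Lemma truncate_nonface F z : nonface_ideal [:: F] (z - truncate F z).
Proof.
rewrite {1}[z]mpolyE (bigID (fun m => supp m \subset F)) /= addrC addrK.
apply: ideal_sum => [|m mF]; first exact: nonface_idealP.
by apply: nonface_ideal_term => G; rewrite inE => /eqP->.
Qed.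

(** * Algebraic independence along a chain of primes *)

Section Independence.
Variables (N : nat) (y : nat -> S).

(* The polynomial with coefficients [c] and degrees less than [N], evaluated
   at [y i], ..., [y (i + k - 1)]. *)
Fixpoint multi_eval k i : (k.-tuple 'I_N -> K) -> S :=
  if k is k'.+1 then fun c =>
    \sum_(j < N) y i ^+ j * multi_eval i.+1 (fun t : k'.-tuple 'I_N => c (cons_tuple j t))
  else fun c => (c [tuple])%:MP.

Lemma multi_eval_ext k i (c d : k.-tuple 'I_N -> K) :
  c =1 d -> multi_eval i c = multi_eval i d.
Proof.
elim: k i c d => [|k IH] i c d cd /=; first by rewrite cd.
by apply: eq_bigr => j _; congr (_ * _); apply: IH => t; apply: cd.
Qed.

Lemma multi_eval_linear k i a (c d : k.-tuple 'I_N -> K) :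
  multi_eval i (fun t => a * c t + d t) = a *: multi_eval i c + multi_eval i d.
Proof.
elim: k i c d => [|k IH] i c d /=.
  by rewrite mpolyCD mpolyCM mul_mpolyC.
rewrite scaler_sumr -big_split; apply: eq_bigr => j _ /=.
by rewrite IH mulrDr scalerAr.
Qed.

Lemma multi_eval_zero k i (c : k.-tuple 'I_N -> K) :
  (forall t, c t = 0) -> multi_eval i c = 0.
Proof.
move=> c0; have /multi_eval_ext-> : c =1 (fun t => -1 * c t + c t).
  by move=> t; rewrite c0 mulr0 addr0.
by rewrite multi_eval_linear scaleN1r addNr.
Qed.

Lemma multi_eval_bounded F B k i (c : k.-tuple 'I_N -> K) :
  (forall j, (j < i + k)%N -> bounded F B (y j)) -> bounded F (k * (N * B)) (multi_eval i c).
Proof.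
elim: k i c => [|k IH] i c yb /=; first exact: boundedC.
apply: bounded_sum => j; rewrite mulSn; apply: boundedM.
  apply: boundedW _ (boundedX (yb i _)); last by rewrite addnS ltnS leq_addr.
  by rewrite leq_mul2r ltnW ?orbT.
by apply: IH => l; rewrite addSnnS; apply: yb.
Qed.

(* A relation in [Q i] can be divided by the lowest power of [y i], which is
   not in [Q i]; the remaining part free of [y i] lies in [Q i.+1]. *)
Lemma multi_eval_indep K0 Q k i (c : k.-tuple 'I_N -> K) :
  chain_of_primes K0 Q -> (i + k <= K0)%N ->
  (forall j, (j < K0)%N -> Q j.+1 (y j) /\ ~ Q j (y j)) ->
  Q i (multi_eval i c) -> forall t, c t = 0.
Proof.
move=> [Qpr Qst] + yQ; elim: k i c => [|k IH] i c ik Qc t.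
  have [idQ Q1 _] := Qpr i (leq_trans (leq_addr _ _) ik).
  rewrite (tuple0 t); apply/eqP; apply: contrapT => /negP c0; apply: Q1.
  by rewrite -(mpolyC1 n K) -(mulVf c0) mpolyCM; apply: idealMl.
have iK0 : (i < K0)%N by move: ik; clear; lia.
have [idQ Q1 QM] := Qpr i (ltnW iK0); have [idQ' Q1' QM'] := Qpr i.+1 iK0.
have [yiS yi] := yQ i iK0.
suff h (j : 'I_N) : forall t', c (cons_tuple j t') = 0 by case/tupleP: t => j t'; apply: h.
have [l] := ubnP (val j); elim: l j => // l IHl j; rewrite ltnS => jl.
pose g (j : 'I_N) := multi_eval i.+1 (fun t : k.-tuple 'I_N => c (cons_tuple j t)).
apply: (IH i.+1); first by rewrite addSnnS.
rewrite -/(g j).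
have gz (j' : 'I_N) : (j' < j)%N -> g j' = 0.
  by move=> jj; apply: multi_eval_zero; apply: IHl; apply: leq_trans jj jl.
(* For [j' < j] the truncated exponent is meaningless, but then [g j'] is 0. *)
pose h := \sum_(j' < N | j' != j) y i ^+ (j' - j).-1 * g j'.
have Qcj : Q i (y i ^+ j * (g j + y i * h)).
  move: Qc => /=; rewrite (bigD1 j) //=; congr (Q i _).
  rewrite mulrDr -/(g j); congr (_ + _); rewrite /h !mulr_sumr.
  apply: eq_bigr => j' jj; rewrite -/(g j').
  have [/gz->|lejj] := ltnP j' j; first by rewrite !mulr0.
  rewrite !mulrA -exprSr -exprD; congr (_ ^+ _ * _).
  rewrite -val_eqE /= in jj; move: jj lejj; clear; lia.
case: (QM _ _ Qcj) => [Qy|/(Qst i iK0).1 Qg].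
  by elim: (val j) Qy => [//|e IHe]; rewrite exprS => /QM[].
rewrite -(addrK (y i * h) (g j)); apply: (idealB idQ') => //.
exact: (idealMr idQ').
Qed.

End Independence.

(** * Algebraic relations by counting monomials *)

Section Counting.
Variables (N k B : nat) (y : nat -> S) (F : {set V}).

Definition box_mnm (g : {ffun {v | v \in F} -> 'I_B}) : 'X_{1..n} :=
  [multinom (if insub (enum_val i) is Some u then val (g u) else 0%N) | i < n].

Definition coord (u : 'rV[K]_#|{: k.-tuple 'I_N}|) (t : k.-tuple 'I_N) : K :=
  u 0 (enum_rank t).

Definition box_coef (u : 'rV[K]_#|{: k.-tuple 'I_N}|) :
    'rV[K]_#|{: {ffun {v | v \in F} -> 'I_B}}| :=
  \row_j (multi_eval y 0 (coord u))@_(box_mnm (enum_val j)).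

Lemma box_coef_is_linear : linear box_coef.
Proof.
move=> a u w; apply/rowP => j; rewrite !mxE -mcoeffZ -mcoeffD.
rewrite -multi_eval_linear; congr (_@__); apply: multi_eval_ext => t.
by rewrite /coord !mxE.
Qed.

HB.instance Definition _ := GRing.isLinear.Build K _ _ _ box_coef box_coef_is_linear.

(* There are more monomials in the [y i] than monomials they can involve. *)
Lemma algebraic_relation : (B ^ #|F| < N ^ k)%N ->
  (forall c : k.-tuple 'I_N -> K, bounded F B.-1 (multi_eval y 0 c)) -> (0 < B)%N ->
  exists2 c : k.-tuple 'I_N -> K, multi_eval y 0 c = 0 & exists t, c t != 0.
Proof.
move=> lt bd B0.
have : kermx (lin1_mx box_coef) != 0.
  rewrite -mxrank_eq0 mxrank_ker -lt0n subn_gt0.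
  apply: (leq_ltn_trans (rank_leq_col _)).
  by rewrite card_ffun card_sig card_tuple !card_ord.
case/rowV0Pn => u /sub_kermxP; rewrite mul_rV_lin1 /= => uE u0.
exists (coord u); last first.
  have /rV0Pn[i ui] := u0; exists (enum_val i).
  by rewrite /coord enum_valK.
apply/mpolyP => m; rewrite mcoeff0; apply/eqP; apply: contrapT => /negP.
rewrite -mcoeff_msupp => mu; have [mF mB] := bd _ _ mu.
have mB' i : (m i < B)%N by rewrite -(prednK B0) ltnS.
pose g := [ffun w : {v | v \in F} => Ordinal (mB' (enum_rank (val w)))].
have mE : m = box_mnm g.
  apply/mnmP => i; rewrite mnmE; case: insubP => [w _ wi|iF].
    by rewrite ffunE /= wi enum_valK.
  apply/eqP; apply: contraNT iF => mi; apply: (subsetP mF).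
  by rewrite inE enum_valK.
move/rowP: uE => /(_ (enum_rank g)); rewrite !mxE enum_rankK -mE => /eqP.
by rewrite mcoeff_eq0 mu.
Qed.

End Counting.

Lemma nonface_chain_bound (fs : seq {set V}) d k Q :
  (forall F, F \in fs -> (#|F| <= d)%N) -> chain_of_primes k Q ->
  (forall z, nonface_ideal fs z -> Q 0%N z) -> (k <= d)%N.
Proof.
move=> fsd Qch fsQ; rewrite leqNgt; apply/negP => dk; have [Qpr Qst] := Qch.
have [idQ Q1 QM] := Qpr 0%N isT.
have Qmono i j z : (i <= j <= k)%N -> Q i z -> Q j z.
  case/andP; move/subnKC <-; elim: (j - i)%N => [|l IH]; first by rewrite addn0.
  by rewrite addnS => lk Qz; apply: (Qst _ lk).1; apply: IH (ltnW lk) Qz.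
(* The product of the variables outside the prime [Q 0] is not in [Q 0], so their set [G] lies in
   some [F] of [fs]; then [P_F] is inside [Q 0]. *)
pose G := [set v | ~~ `[< Q 0%N (var K v) >]].
have [F Ffs GF] : exists2 F, F \in fs & G \subset F.
  apply: contrapT => none.
  have : Q 0%N 'X_[sqfree_mnm G].
    apply: fsQ; rewrite -['X_[_]]scale1r; apply: nonface_ideal_term => F Ffs.
    by rewrite supp_sqfree_mnm; apply/negP => GF; apply: none; exists F.
  rewrite -sqfree_monomialE /sqfree_monomial.
  apply: (big_ind (fun z => ~ Q 0%N z)) => // [z1 z2 n1 n2 /QM[]//|v].
  by rewrite inE => /negP; apply: contra_not => ?; apply/asboolP.
have QF z : nonface_ideal [:: F] z -> Q 0%N z.
  apply: nonface_ideal_gen => // v vF; apply: contrapT => Qv.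
  by move/negP: vF; apply; apply: (subsetP GF); rewrite inE; apply/asboolPn.
have /choice[y0 y0P] i : exists z, (i < k)%N -> Q i.+1 z /\ ~ Q i z.
  have [/Qst[_ [z zP]]|_] := boolP (i < k)%N; first by exists z.
  by exists 0.
(* Truncation changes [y0 i] by an element of [P_F], hence of every prime of the chain. *)
pose y i := truncate F (y0 i).
have yP i : (i < k)%N -> Q i.+1 (y i) /\ ~ Q i (y i).
  move=> ik; have [Qy nQy] := y0P i ik.
  have Qd j : (j <= k)%N -> Q j (y0 i - y i).
    by move=> jk; apply: (Qmono 0%N); rewrite ?jk //; apply/QF/truncate_nonface.
  have idQj j : (j <= k)%N -> is_ideal (Q j) by case/Qpr.
  split; first exact: (ideal_cong (idQj _ ik) (Qd _ ik)).1 Qy.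
  by move/(ideal_cong (idQj _ (ltnW ik)) (Qd _ (ltnW ik))).2.
pose B := \max_(i < d.+1) msize (y0 i).
have yb j : (j < d.+1)%N -> bounded F B (y j).
  move=> jd; apply: boundedW _ (@truncate_bounded F (y0 j)).
  exact: (leq_bigmax (Ordinal jd)).
(* The [N ^ d.+1] monomials in the [y i] have exponents below [B'] in the variables of [F]. As
   [B' <= N * C], they involve at most [N ^ d * C ^ d] monomials, and [N] exceeds [C ^ d]. *)
pose C := (d.+1 * B).+1; pose N := (C ^ d).+1.
pose B' := (d.+1 * (N * B)).+1.
have B'N : (B' <= N * C)%N.
  rewrite /B' /C mulnS [(N * (_ * _))%N]mulnCA -addn1 addnC leq_add2r.
  by rewrite /N.
have count : (B' ^ #|F| < N ^ d.+1)%N.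
  have B'd : (B' ^ #|F| <= (N * C) ^ d)%N.
    rewrite (leq_trans (leq_pexp2l _ (fsd _ Ffs))) //.
    by case: (d) (B'N) => // d' le; rewrite leq_exp2r.
  rewrite (leq_ltn_trans B'd) // expnMn expnSr ltn_pmul2l ?expn_gt0 //.
have bd (c : d.+1.-tuple 'I_N -> K) : bounded F B'.-1 (multi_eval y 0 c).
  exact: multi_eval_bounded.
have [c c0 [t ct]] := algebraic_relation count bd isT.
move/negP: ct; apply; apply/eqP.
apply: (multi_eval_indep (y := y) (i := 0%N) Qch) => //.
by rewrite c0; apply: ideal0.
Qed.

End Dimension.

(** * Extension of ideals to rings of fractions *)

Section Extension.
Variables (R A : comNzRingType) (f : {rmorphism R -> A}) (I0 : R -> Prop).

Definition invertible (z : A) : Prop := exists w, w * z = 1.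

Hypothesis frac_f : frac_morph f.
(** Together with [frac_f], this makes [A] a localization of [R / I0] when [I0] is an ideal, so that
    quotient and localization are treated in one step. *)
Hypothesis ker_f : forall z, f z = 0 <-> exists u, invertible (f u) /\ I0 (u * z).

Definition ext (I : R -> Prop) : A -> Prop :=
  fun z => exists t a, [/\ invertible (f t), I a & f t * z = f a].

Lemma invertible1 : invertible 1.
Proof. by exists 1; rewrite mulr1. Qed.

Lemma invertibleM (z1 z2 : A) : invertible z1 -> invertible z2 -> invertible (z1 * z2).
Proof.
move=> [w1 e1] [w2 e2]; exists (w1 * w2).
by rewrite mulrACA e1 e2 mulr1.
Qed.

Section OneIdeal.
Variables (I : R -> Prop) (idI : is_ideal I) (I0I : forall x, I0 x -> I x).

Lemma ext_map x : ext I (f x) <-> exists u, invertible (f u) /\ I (u * x).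
Proof.
split=> [[t [a [ti Ia e]]]|[u [ui Iux]]]; last by exists u, (u * x); rewrite rmorphM.
have /ker_f[u [ui /I0I h]] : f (t * x - a) = 0 by rewrite rmorphB rmorphM e subrr.
exists (u * t); rewrite rmorphM; split; first exact: invertibleM.
rewrite (_ : u * t * x = u * (t * x - a) + u * a); last by ring.
by apply: (idealD idI) => //; apply: idealMl.
Qed.

Lemma ext_ideal : is_ideal (ext I).
Proof.
split; first by exists 1, 0; rewrite rmorph1 rmorph0 mulr0; split=> //;
  [exact: invertible1|exact: ideal0].
move=> c x y [t [a [ti Ia ta]]] [s [b [si Ib sb]]].
have [r [e [ri re]]] := frac_f c.
exists (r * t * s), (s * e * a + r * t * b); rewrite rmorphD !rmorphM; split.
- by do 2?apply: invertibleM.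
- by apply: idI.2 => //; apply: idealMl.
- by rewrite -re -ta -sb; ring.
Qed.

Lemma ext_unit t z : invertible (f t) -> ext I (f t * z) <-> ext I z.
Proof.
move=> [w wt]; split=> [h|]; last exact: (idealMl ext_ideal).
by rewrite -[z]mul1r -wt -mulrA; apply: (idealMl ext_ideal).
Qed.

Lemma nzd_ext_map t : nzd I t -> nzd (ext I) (f t).
Proof.
move=> nt z; have [s [a [si sa]]] := frac_f z.
rewrite -(ext_unit _ si) -[ext I z](ext_unit _ si) mulrCA sa -rmorphM.
by case/ext_map=> u [ui]; rewrite mulrCA => /nt ua; apply/ext_map; exists u.
Qed.

Lemma ext_adjoin t z : ext (adjoin I t) z <-> adjoin (ext I) (f t) z.
Proof.
have idA := adjoin_ideal t idI.
split=> [[s [a [[w ws] [c ac] sa]]]|[b bz]].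
  exists (w * f c); rewrite -[z]mul1r -ws -mulrA sa -mulrA -mulrBr -rmorphM -rmorphB.
  by apply: (idealMl ext_ideal); apply/ext_map; exists 1; rewrite rmorph1 mul1r;
    split=> //; apply: invertible1.
have [s [a [si sa]]] := frac_f z; have [r [e [ri re]]] := frac_f b.
have : ext I (f (r * a - s * e * t)).
  rewrite rmorphB !rmorphM -sa -re.
  rewrite (_ : _ - _ = f r * f s * (z - b * f t)); last by ring.
  exact: (idealMl ext_ideal).
case/ext_map=> u [ui uI]; exists (u * r * s), (u * r * a); rewrite !rmorphM; split.
- by do 2?apply: invertibleM.
- by exists (u * s * e); rewrite (_ : _ - _ = u * (r * a - s * e * t)) //; ring.
- by rewrite -sa; ring.
Qed.

End OneIdeal.

Lemma weakly_regular_ext_map I s : is_ideal I -> (forall x, I0 x -> I x) ->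
  weakly_regular I s -> weakly_regular (ext I) (map f s).
Proof.
elim: s I => //= t s IH I idI I0I [nt rs]; split; first exact: nzd_ext_map.
have : weakly_regular (ext (adjoin I t)) (map f s).
  by apply: IH (adjoin_ideal t idI) _ rs => x /I0I; apply: adjoin_sub.
exact/weakly_regular_ext/ext_adjoin.
Qed.

Lemma ext_colon I C t z : is_ideal I -> is_ideal C ->
  (forall x, I0 x -> I x) -> (forall x, I0 x -> C x) ->
  (forall x, C x <-> I (t * x)) -> ext C z <-> ext I (f t * z).
Proof.
move=> idI idC I0I I0C CI; have [s [a [si sa]]] := frac_f z.
rewrite -(ext_unit idC _ si) -(ext_unit idI _ si) mulrCA sa -rmorphM.
rewrite (ext_map idC) // (ext_map idI) //.
by split=> -[u [ui h]]; exists u; split=> //; move: h; rewrite mulrCA => /CI.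
Qed.

Lemma ext_ker z : ext I0 z <-> z = 0.
Proof.
split=> [[t [a [[w wt] Ia ta]]]|->]; last first.
  have /ker_f[u [ui h]] : f 0 = 0 by rewrite rmorph0.
  rewrite mulr0 in h; exists 1, 0; rewrite rmorph1 mulr0 rmorph0.
  by split=> //; apply: invertible1.
have fa : f a = 0.
  by apply/ker_f; exists 1; rewrite rmorph1 mul1r; split=> //; apply: invertible1.
by rewrite -[z]mul1r -wt -mulrA ta fa mulr0.
Qed.

End Extension.

Lemma weakly_regular_unit (R : comNzRingType) (I : R -> Prop) a :
  (forall x, I x) -> weakly_regular I a.
Proof. by elim: a I => //= t a IH I Iall; split=> //; apply: IH => x; apply: adjoin_sub. Qed.

(** * Localizations of the Stanley-Reisner ring of a shelling *)

Section LocalShelling.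
Variables (K : fieldType) (V : finType) (fs : seq {set V}) (d : nat).
Notation S := {mpoly K[#|V|]}.
Variables (A : comNzRingType) (f : {rmorphism S -> A}) (m : A -> Prop).
Variable p : V -> {poly K}.

Hypothesis noethA : noetherian A.
Hypothesis frac_f : frac_morph f.
Hypothesis ker_f :
  forall z, f z = 0 <-> exists u, invertible (f u) /\ nonface_ideal fs (u * z).
Hypothesis idm : is_ideal m.
Hypothesis m1 : ~ m 1.
Hypothesis local_m : forall z, ~ m z -> invertible z.
Hypothesis p_monic : forall v, p v \is monic.
Hypothesis p_m : forall v, m (f (peval (p v) v)).
Hypothesis p_X : forall v, m (f (var K v)) -> p v = 'X.
Hypothesis fs_card : forall F, F \in fs -> #|F| = d.

(** Symmetric polynomials in all [q_v] give one sequence for all facets: when [P_F] is inside [m],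
    those [q_v] with [v] outside [F] vanish modulo [P_F]. *)
Let theta := esyms [seq f (peval (p v) v) | v <- enum V] d.

Lemma max_jacobson x : m x -> jacobson x.
Proof.
move=> mx c; apply: local_m => mc; apply: m1.
by rewrite -(subrK (c * x) 1); apply: (idealD idm) => //; apply: idealMl.
Qed.

Lemma nonface_ideal_sub (gs gs' : seq {set V}) (z : S) : {subset gs' <= gs} ->
  nonface_ideal gs z -> @nonface_ideal K V gs' z.
Proof. by move=> sub zI k kz F /sub; apply: zI. Qed.

Lemma face_regular F : F \in fs -> weakly_regular (ext f (nonface_ideal [:: F])) theta.
Proof.
move=> Ffs; have idF := @nonface_idealP K V [:: F].
have subF (z : S) : nonface_ideal fs z -> nonface_ideal [:: F] z.
  by move=> zI; apply: nonface_ideal_sub zI => G; rewrite inE => /eqP->.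
have idE := ext_ideal frac_f idF.
(* If some variable outside [F] becomes a unit in [A], then [P_F] extends to the unit ideal. *)
have [[v [vF vm]]|allm] := pselect (exists v, v \notin F /\ ~ m (f (var K v))).
  apply: weakly_regular_unit => z; have [w wv] := local_m vm.
  rewrite -[z]mulr1 -wv mulrA; apply: (idealMl idE).
  apply/(ext_map ker_f idF subF); exists 1; rewrite rmorph1 mul1r.
  by split; [apply: invertible1|apply: var_nonface].
have mF v : v \notin F -> m (f (var K v)).
  by move=> vF; apply: contrapT => vm; apply: allm; exists v.
pose q v := f (peval (p v) v).
have rF : weakly_regular (ext f (nonface_ideal [:: F])) (esyms (map q (enum F)) d).
  apply: weakly_regular_esym => //; first by rewrite -cardE fs_card.
    by move=> v _; apply/max_jacobson/p_m.
  move=> s ps; rewrite (map_comp f (fun v => peval (p v) v)).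
  apply: (weakly_regular_ext_map frac_f ker_f) => //.
  apply: weakly_regular_peval => //; first by rewrite -(perm_uniq ps) enum_uniq.
  by move=> v; rewrite -(perm_mem ps) mem_enum; apply: stable_nonface.
apply: weakly_regular_cong rF => // k _; rewrite -opprB; apply: (idealN idE).
have pV : perm_eq (enum V) (enum (~: F) ++ enum F).
  apply: uniq_perm; rewrite ?enum_uniq // ?cat_uniq ?enum_uniq ?andbT /=.
    by apply/hasPn => v /=; rewrite !mem_enum inE negbK.
  by move=> v; rewrite mem_cat !mem_enum !inE orNb.
rewrite (perm_esym (perm_map q pV)) map_cat; apply: esym_cong_cat => //.
move=> y /mapP[v]; rewrite mem_enum inE => vF ->.
apply/(ext_map ker_f idF subF); exists 1; rewrite rmorph1 mul1r.
split; first exact: invertible1.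
by rewrite (p_X (mF _ vF)) /peval map_polyX hornerX; apply: var_nonface.
Qed.

(** Induction over the initial segments of the shelling, with [A] and [f] fixed. The empty segment
    gives the unit ideal, and [weakly_regular_colon] adds a facet. *)
Lemma shelling_regular : shelling fs -> weakly_regular (fun z => z = 0) theta.
Proof.
move=> sh; suff: weakly_regular (ext f (nonface_ideal fs)) theta.
  by apply: weakly_regular_ext; apply: ext_ker.
have : {subset fs <= fs} by [].
elim/last_ind: {-3}fs sh => [|gs F IH] sh sub.
  apply: weakly_regular_unit => z; have [t [a [ti ta]]] := frac_f z.
  by exists t, a.
have [shgs shF] := shelling_rcons sh.
have sub' gs' : {subset gs' <= rcons gs F} ->
    forall z : S, nonface_ideal fs z -> @nonface_ideal K V gs' z.
  by move=> h z zI; apply: nonface_ideal_sub zI => G /h/sub.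
have sgs : {subset gs <= rcons gs F} by move=> G Ggs; rewrite mem_rcons inE Ggs orbT.
have sF : {subset [:: F] <= rcons gs F}.
  by move=> G; rewrite mem_rcons !inE => ->.
have idI := @nonface_idealP K V.
have Ffs : F \in fs by apply: sub; rewrite mem_rcons mem_head.
apply: (weakly_regular_colon (t := f 'X_[sqfree_mnm (restriction gs F)])
  (J := ext f (nonface_ideal gs)) (C := ext f (nonface_ideal [:: F]))).
- exact: ext_ideal.
- move=> z; rewrite -(ext_adjoin frac_f ker_f (idI _) (sub' _ _)) //.
  by split=> -[t [a [ti /(nonface_ideal_adjoin shF) Ia ta]]]; exists t, a.
- move=> z; apply: (ext_colon frac_f ker_f) => //; try exact: sub'.
  by move=> x; apply: nonface_ideal_colon.
- by apply: IH => // G /sgs/sub.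
- exact: face_regular.
Qed.

Lemma theta_max z : z \in theta -> m z.
Proof.
case/mapP=> k; rewrite mem_iota => /andP[k1 _] ->; rewrite -(prednK k1).
by apply: esym_ideal => // y /mapP[v _ ->].
Qed.

Lemma size_theta : size theta = d.
Proof. by rewrite size_map size_iota. Qed.

Lemma theta_regular : shelling fs -> regular_sequence theta.
Proof.
move=> sh; split; first exact/weakly_regularP/shelling_regular.
by move=> /(ideal_span_sub idm theta_max).
Qed.

Lemma local_chain_bound k (P : 'I_k.+1 -> {pred A}) : prime_chain P -> (k <= d)%N.
Proof.
move=> Pch; have [|Q [Qpr Qst]] := (chain_of_primesP A k).2; first by exists P.
apply: (nonface_chain_bound (fs := fs) (Q := fun i z => Q i (f z))) => //.
- by move=> F /fs_card ->.
- split=> i ik.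
    have [idQ Q1 QM] := Qpr i ik; split; last by move=> x y; rewrite rmorphM; apply: QM.
      split=> [|c x y]; first by rewrite rmorph0; apply: ideal0.
      by rewrite rmorphD rmorphM; apply: idQ.2.
    by rewrite rmorph1.
  have [sub [z [Qz nQz]]] := Qst i ik; split=> [x|]; first exact: sub.
  have [idQ _ _] := Qpr i (ltnW ik); have [idQ' _ _] := Qpr i.+1 ik.
  have [t [a [[w wt] ta]]] := frac_f z; exists a; rewrite -ta; split.
    exact: idealMl.
  by move=> h; apply: nQz; rewrite -[z]mul1r -wt -mulrA; apply: idealMl.
- move=> z zI; have [idQ _ _] := Qpr 0%N isT; rewrite (_ : f z = 0); first exact: ideal0.
  by apply/ker_f; exists 1; rewrite rmorph1 mul1r; split=> //; apply: invertible1.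
Qed.

(** The sequence [theta] bounds the depth from below and, through [regular_sequence_chain], the
    dimension as well. Both are bounded above by [local_chain_bound]. *)
Lemma shelling_cohen_macaulay : shelling fs -> cohen_macaulay_local A.
Proof.
move=> sh; split=> //; pose M : {pred A} := fun z => `[< m z >].
have closedM : idealr_closed M.
  split=> [||c x y /asboolP mx /asboolP my]; first exact/asboolP/(ideal0 idm).
    by apply/negP => /asboolP.
  by apply/asboolP/idm.2.
have subM (I : {pred A}) : idealr_closed I -> {subset I <= M}.
  move=> [I0 I1 ID] z Iz; apply/asboolP; apply: contrapT => /local_m[w wz].
  by case/negP: I1; rewrite -wz -[w * z]addr0 ID.
have maxM : maximal_ideal M by split=> // I /subM.
exists M; split=> // [m' [idm' max'] z|].
  by apply/idP/idP; [apply: subM|apply: max' => //; apply: subM].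
exists d; split.
- exists theta; rewrite size_theta; split=> //; last exact: theta_regular.
  by move=> z /theta_max ?; apply/asboolP.
- by move=> k [a [<- _ /regular_sequence_chain[P /local_chain_bound]]].
- by have := regular_sequence_chain (theta_regular sh); rewrite size_theta.
- by move=> k [P /local_chain_bound].
Qed.

End LocalShelling.

(** * Quotients and localizations *)

Section QuotientMap.
Variables (R : comNzRingType) (I : idealr R).

Definition quot_map (x : R) : {ideal_quot I} := \pi x.

Lemma quot_map_is_zmod_morphism : zmod_morphism quot_map.
Proof. by move=> x y; rewrite /quot_map !piE. Qed.

Lemma quot_map_is_monoid_morphism : monoid_morphism quot_map.
Proof. by split=> [|x y]; rewrite /quot_map !piE. Qed.

HB.instance Definition _ := GRing.isZmodMorphism.Build R {ideal_quot I}
  quot_map quot_map_is_zmod_morphism.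
HB.instance Definition _ := GRing.isMonoidMorphism.Build R {ideal_quot I}
  quot_map quot_map_is_monoid_morphism.

Lemma quot_map_surj z : exists x, quot_map x = z.
Proof. by exists (repr z); rewrite /quot_map reprK. Qed.

Lemma quot_map_eq0 x : quot_map x = 0 <-> x \in I.
Proof.
rewrite -(rmorph0 quot_map) -{2}[x]subr0 Quotient.idealrBE.
by split=> /eqP.
Qed.

End QuotientMap.

Section LocalizationMap.
Variables (R : comNzRingType) (P : prime_idealr R).

Definition loc_map (x : R) : localization P := \pi_(localization P) (mkfrac x (den1 P)).

Lemma loc_map_is_zmod_morphism : zmod_morphism loc_map.
Proof.
move=> x y; transitivity (\pi_(localization P)
    (fracD (mkfrac x (den1 P)) (fracN (mkfrac y (den1 P))))); last first.
  by rewrite pi_locD pi_locN.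
by apply/eqP/frac_eqP; exists 1; [exact: den1|rewrite /=; ring].
Qed.

Lemma loc_map_is_monoid_morphism : monoid_morphism loc_map.
Proof.
split=> [|x y].
  by rewrite -[RHS]/(loc1 P) piE.
transitivity (\pi_(localization P) (fracM (mkfrac x (den1 P)) (mkfrac y (den1 P)))).
  by apply/eqP/frac_eqP; exists 1; [exact: den1|rewrite /=; ring].
exact: pi_locM.
Qed.

HB.instance Definition _ := GRing.isZmodMorphism.Build R (localization P)
  loc_map loc_map_is_zmod_morphism.
HB.instance Definition _ := GRing.isMonoidMorphism.Build R (localization P)
  loc_map loc_map_is_monoid_morphism.

Lemma loc_map_eq x y : loc_map x = loc_map y <-> exists2 u, u \notin P & u * x = u * y.
Proof.
split=> [/eqP/frac_eqP[u uP]|[u uP e]].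
  by rewrite /= !mulr1; exists u.
by apply/eqP/frac_eqP; exists u; rewrite //= !mulr1.
Qed.

Lemma loc_map_frac z : exists t a, t \notin P /\ loc_map t * z = loc_map a.
Proof.
have [[[a t] /= tP] zE] : exists x, z = \pi_(localization P) x.
  by exists (repr z); rewrite reprK.
exists t, a; split=> //; rewrite {}zE.
transitivity (\pi_(localization P) (fracM (mkfrac t (den1 P))
    (exist (fun x : R * R => x.2 \notin P) (a, t) tP))).
  by rewrite pi_locM.
by apply/eqP/frac_eqP; exists 1; [exact: den1|rewrite /=; ring].
Qed.

Lemma invertible_loc_map t : invertible (loc_map t) <-> t \notin P.
Proof.
split=> [[w wt]|tP].
  have [s [a [sP sw]]] := loc_map_frac w.
  have /loc_map_eq[u uP e] : loc_map s = loc_map (a * t).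
    by rewrite rmorphM /= -sw -mulrA wt mulr1.
  have : u * s \notin P by rewrite prime_idealrM negb_or uP.
  by apply: contra => tP; rewrite e mulrA ring_quotient.idealMr.
exists (\pi_(localization P) (mkfrac 1 tP)).
transitivity (\pi_(localization P) (fracM (mkfrac 1 tP) (mkfrac t (den1 P)))).
  by rewrite pi_locM.
rewrite -(rmorph1 loc_map).
by apply/eqP/frac_eqP; exists 1; [exact: den1|rewrite /=; ring].
Qed.

Lemma loc_map_frac_morph : frac_morph loc_map.
Proof.
move=> z; have [t [a [/invertible_loc_map ti ta]]] := loc_map_frac z.
by exists t, a.
Qed.

Lemma loc_map_ker x : loc_map x = 0 <->
  exists u, invertible (loc_map u) /\ u * x = 0.
Proof.
rewrite -(rmorph0 loc_map) loc_map_eq.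
split=> [[u /invertible_loc_map ui]|[u [/invertible_loc_map ui e]]].
  by rewrite mulr0; exists u.
by exists u; rewrite ?mulr0.
Qed.

Definition loc_max : localization P -> Prop := ext loc_map (fun x => x \in P).

Lemma prime_is_ideal : is_ideal (fun x => x \in P).
Proof.
split=> [|c x y Px Py]; first exact: idealr0.
by rewrite rpredD // ring_quotient.idealMr.
Qed.

Lemma loc_max_ideal : is_ideal loc_max.
Proof. exact: (ext_ideal loc_map_frac_morph prime_is_ideal). Qed.

Lemma loc_max_map x : loc_max (loc_map x) <-> x \in P.
Proof.
rewrite /loc_max (ext_map (I0 := fun y => y = 0) loc_map_ker prime_is_ideal) => [|_ ->]; last exact: idealr0.
split=> [[u [/invertible_loc_map/negPf uP]]|Px]; first by rewrite prime_idealrM uP.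
by exists 1; rewrite mul1r rmorph1; split=> //; apply: invertible1.
Qed.

Lemma loc_max1 : ~ loc_max 1.
Proof. by rewrite -(rmorph1 loc_map) loc_max_map idealr1. Qed.

Lemma loc_max_local z : ~ loc_max z -> invertible z.
Proof.
have [t [a [tP ta]]] := loc_map_frac z; have [aP mz|aP _] := boolP (a \in P).
  by case: mz; exists t, a; split=> //; apply/invertible_loc_map.
have /invertible_loc_map[w wa] := aP.
by exists (w * loc_map t); rewrite -mulrA ta.
Qed.

End LocalizationMap.

(** * Pure shellable complexes are Cohen-Macaulay *)

Lemma generated_mpoly (K : fieldType) (V : finType) (A : comNzRingType)
    (g : {rmorphism {mpoly K[#|V|]} -> A}) : (forall z, exists x, g x = z) ->
  generated (g \o @mpolyC #|V| K) [seq g (var K v) | v <- enum V].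
Proof.
move=> gsurj B [B1 BB BM] Bc Bv z; have [x <-] := gsurj z.
have B0 : B 0 by rewrite -(subrr 1); apply: BB.
have BD y1 y2 : B y1 -> B y2 -> B (y1 + y2).
  by move=> b1 b2; rewrite -[y2]opprK -[X in _ - X]sub0r; apply/BB/BB.
rewrite [x]mpolyE rmorph_sum; apply: (big_ind B) => // m _.
rewrite -mul_mpolyC rmorphM; apply: (BM); first exact: Bc.
rewrite mpolyXE_id rmorph_prod; apply: (big_ind B B1 BM) => i _; rewrite rmorphXn.
have Bi : B (g 'X_i).
  by apply: Bv; apply/mapP; exists (enum_val i); rewrite ?mem_enum // /var enum_valK.
by elim: (m i) => [|k IH]; rewrite ?expr0 // exprS; apply: (BM).
Qed.

Lemma quotient_fieldlike (R : comNzRingType) (P : prime_idealr R) (z : {ideal_quot P}) :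
  maximal_ideal P -> z != 0 -> exists w, w * z = 1.
Proof.
move=> [_ maxP]; have [x <-] := quot_map_surj z => xP.
pose J : {pred R} := fun y => `[< adjoin (fun a => a \in P) x y >].
have idJ := adjoin_ideal x (prime_is_ideal P).
have /asboolP[c Pc] : 1 \in J.
  apply: contraTT xP => J1; rewrite negbK; apply/eqP/quot_map_eq0.
  apply: (maxP J); last by apply/asboolP/adjoin_self/prime_is_ideal.
    split=> [||c y1 y2 /asboolP h1 /asboolP h2] //; first exact/asboolP/(ideal0 idJ).
    by apply/asboolP/idJ.2.
  by move=> y Py; apply/asboolP/adjoin_sub.
exists (quot_map P c); move/quot_map_eq0: Pc.
by rewrite rmorphB rmorphM rmorph1 => /eqP; rewrite subr_eq0 eq_sym => /eqP.
Qed.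

Section ShellableComplex.
Variables (K : fieldType) (V : finType) (D : scomplex V).
Notation S := {mpoly K[#|V|]}.

Definition SR_map : S -> SR_ring K D := @quot_map S (@SR_ideal K V D).
HB.instance Definition _ := GRing.RMorphism.on SR_map.

Lemma SR_map_surj z : exists x, SR_map x = z.
Proof. exact: quot_map_surj. Qed.

Lemma SR_ring_noetherian : noetherian (SR_ring K D).
Proof.
exact: generated_noetherian (generated_mpoly SR_map_surj) (@field_noetherian K).
Qed.

(** The residue ring is a finitely generated [K]-algebra in which nonzero elements are invertible,
    so the image of the variable is algebraic over [K]. *)
Lemma maximal_ideal_peval (P : prime_idealr (SR_ring K D)) v : maximal_ideal P ->
  exists p : {poly K}, [/\ p \is monic, SR_map (peval p v) \in P &
    SR_map (var K v) \in P -> p = 'X].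
Proof.
move=> maxP; have [vP|vP] := boolP (SR_map (var K v) \in P).
  by exists 'X; rewrite monicX /peval map_polyX hornerX.
have gsurj z : exists x, (quot_map P \o SR_map) x = z.
  have [y <-] := quot_map_surj z; have [x <-] := SR_map_surj y.
  by exists x.
have [p mp pv] := generated_algebraic (fun z => quotient_fieldlike maxP)
  (quot_map P (SR_map (var K v))) (generated_mpoly gsurj).
exists p; split=> //; apply/quot_map_eq0; rewrite -pv /eval_morph /peval.
rewrite (map_poly_comp (quot_map P \o SR_map)).
by rewrite (horner_map (quot_map P \o SR_map)).
Qed.

Theorem pure_shellable_cohen_macaulay :
  pure D -> shellable D -> cohen_macaulay_over K D.
Proof.
move=> pureD [fs [_ fsD] sh]; split=> [|P maxP]; first exact: SR_ring_noetherian.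
have /choice[p pP] v := maximal_ideal_peval v maxP.
pose d := if fs is F :: _ then #|F| else 0%N.
have fsd F : F \in fs -> #|F| = d.
  rewrite /d; case: fs fsD {sh d} => // G fs fsD FG.
  by apply: pureD; rewrite -fsD ?mem_head.
pose f := loc_map P \o SR_map.
apply: (shelling_cohen_macaulay (fs := fs) (d := d) (f := f) (m := @loc_max _ P) (p := p)) => //.
- apply: frac_noetherian SR_ring_noetherian; exact: (loc_map_frac_morph (P := P)).
- move=> z; have [t [a [ti ta]]] := loc_map_frac_morph z.
  have [t' tE] := SR_map_surj t; have [a' aE] := SR_map_surj a.
  by exists t', a'; rewrite /= tE aE.
- move=> z; rewrite /= loc_map_ker; split=> [[u [ui uz]]|[u [ui uz]]].
    have [u' uE] := SR_map_surj u; exists u'; rewrite uE; split=> //.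
    have {uz} : SR_map (u' * z) = 0 by rewrite rmorphM /= uE.
    by move/quot_map_eq0/(SR_idealE fsD).
  exists (SR_map u); split=> //; rewrite -rmorphM.
  by apply/quot_map_eq0/(SR_idealE fsD).
- exact: loc_max_ideal.
- exact: loc_max1.
- exact: loc_max_local.
- by move=> v; have [] := pP v.
- by move=> v; apply/loc_max_map; have [] := pP v.
- by move=> v /loc_max_map; have [] := pP v.
Qed.

End ShellableComplex.

(** * Expansions *)

Section Expansions.
Variables (n : nat) (s : 'I_n -> nat).
Implicit Types (D : scomplex 'I_n) (F : {set 'I_n}) (r : {dffun forall i, 'I_(s i)}).

Lemma in_exp_facet F r x :
  (x \in exp_facet F r) = (tag x \in F) && (r (tag x) == tagged x).
Proof.
apply/imsetP/andP => [[i iF ->]|[xF /eqP rx]]; first by rewrite iF.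
by exists (tag x) => //; rewrite rx taggedK.
Qed.

Lemma Tagged_inj r : injective (fun i => Tagged (fun i => 'I_(s i)) (r i)).
Proof. by move=> i j /(congr1 tag). Qed.

Lemma card_exp_facet F r : #|exp_facet F r| = #|F|.
Proof. exact/card_imset/Tagged_inj. Qed.

Definition level (H : {set exp_vertex s}) : nat := (\sum_(x in H) tagged x)%N.

Lemma level_exp_facet F r : level (exp_facet F r) = (\sum_(i in F) r i)%N.
Proof. by rewrite /level big_imset //= => i j _ _; apply: Tagged_inj. Qed.

Lemma level_bound H : (level H <= \sum_(x : exp_vertex s) tagged x)%N.
Proof. by rewrite /level [leqRHS](bigID (mem H)) /= leq_addr. Qed.

Lemma expansion_pure D : (forall i, (0 < s i)%N) -> pure D -> pure (expansion s D).
Proof.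
move=> s0 pureD G H; rewrite !facets_expansion //.
case/imset2P=> F r FD _ ->; case/imset2P=> F' r' F'D _ ->.
by rewrite !card_exp_facet; apply: pureD.
Qed.

Lemma exp_facet_step F F' r v : v \in F -> F :\: F' = [set v] ->
  exp_facet F r :\: exp_facet F' r = [set Tagged (fun i => 'I_(s i)) (r v)].
Proof.
move=> vF FF'; apply/setP => x; rewrite !inE !in_exp_facet negb_and.
apply/idP/eqP => [/andP[/orP[xF'|/negPf->]] |->].
- case/andP=> xF /eqP rx; have : tag x \in F :\: F' by rewrite inE xF'.
  by rewrite FF' inE => /eqP xv; rewrite -[LHS]taggedK -rx xv.
- by rewrite andbF.
- have : v \in F :\: F' by rewrite FF' inE.
  by rewrite inE /= => /andP[-> ->]; rewrite eqxx.
Qed.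

Lemma exp_facet_lower F r r' v : v \in F -> r v != r' v ->
  exp_facet F r' :\: exp_facet F [ffun i => if i == v then r i else r' i] =
    [set Tagged (fun i => 'I_(s i)) (r' v)].
Proof.
move=> vF rv; apply/setP => x; rewrite !inE !in_exp_facet negb_and ffunE.
apply/idP/eqP => [|->]; last by rewrite /= eqxx vF rv orbT eqxx.
case/andP=> + /andP[xF /eqP rx]; rewrite xF /=.
case: (tag x =P v) => [xv _|_]; last by rewrite rx eqxx.
by rewrite -[LHS]taggedK -rx xv.
Qed.

(** If no coordinate of [r] over [F] were smaller, the inequality of the sums would force equality
    on [F]. *)
Lemma level_lower F r r' : (\sum_(i in F) r i <= \sum_(i in F) r' i)%N ->
  exp_facet F r != exp_facet F r' -> exists2 v, v \in F & (r v < r' v)%N.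
Proof.
move=> le ne; apply: contrapT => none.
have ge i : i \in F -> (r' i <= r i)%N.
  by move=> iF; rewrite leqNgt; apply/negP => lt; apply: none; exists i.
have [allF|] := boolP [forall i in F, r i == r' i].
  case/eqP: ne; apply: eq_in_imset => i iF.
  by rewrite (eqP (forall_inP allF i iF)).
case/forall_inPn => i iF ri; move: le; apply/negP; rewrite -ltnNge.
rewrite (bigD1 i) // [ltnRHS](bigD1 i) //= -addSn leq_add //.
  by rewrite ltn_neqAle ge // andbT eq_sym.
by apply: leq_sum => j /andP[jF _]; apply: ge.
Qed.

(* The facets of the expansion are ordered by the position of their image in
   the given shelling, then by the sum of their second coordinates; ties are
   broken arbitrarily. *)
Lemma expansion_shellable D : (forall i, (0 < s i)%N) ->
  shellable D -> shellable (expansion s D).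
Proof.
move=> s0 [f [uf fD] sh].
(* [B] exceeds every level, so comparing keys is comparing lexicographically. *)
pose B := (\sum_(x : exp_vertex s) tagged x)%N.+1.
pose key (H : {set exp_vertex s}) := (index [set tag x | x in H] f * B + level H)%N.
have keyE F r : key (exp_facet F r) = (index F f * B + level (exp_facet F r))%N.
  by rewrite /key tag_exp_facet.
have key_lt (H H' : {set exp_vertex s}) k : (k < index [set tag x | x in H'] f)%N ->
    index [set tag x | x in H] f = k -> (key H < key H')%N.
  move=> lt e; rewrite /key e (leq_trans _ (leq_addr _ _)) //.
  apply: (@leq_trans (k.+1 * B)); last by rewrite leq_mul2r lt orbT.
  by rewrite mulSn addnC -addSn leq_add2r ltnS level_bound.
have main G H : G \in exp_facets s D -> H \in exp_facets s D -> G != H ->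
    (key G <= key H)%N -> exists2 v, v \in H :\: G &
    exists L, [/\ L \in exp_facets s D, (key L < key H)%N & H :\: L = [set v]].
  case/imset2P=> F r FD _ ->; case/imset2P=> F' r' F'D _ -> ne le.
  have Ff : F \in f by rewrite fD.
  have F'f : F' \in f by rewrite fD.
  have [lt|gt|e] := ltngtP (index F f) (index F' f).
  (* Different positions: the shelling of [D] provides [v] and an earlier facet, which is lifted
     with the same [r']. *)
  - have [|v] := sh (index F f) (index F' f); first by rewrite lt index_mem.
    rewrite !nth_index // => /setDP[vF' vF] [l lF' lv].
    have lf : (l < size f)%N by rewrite (ltn_trans lF') ?index_mem.
    exists (Tagged (fun i => 'I_(s i)) (r' v)).
      by rewrite inE !in_exp_facet /= vF' (negPf vF) eqxx.
    exists (exp_facet (nth set0 f l) r'); split.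
    + by apply/imset2P; exists (nth set0 f l) r'; rewrite // -fD mem_nth.
    + by apply: (key_lt _ _ l); rewrite tag_exp_facet ?index_uniq.
    + exact: exp_facet_step.
  - have := key_lt (exp_facet F' r') (exp_facet F r) (index F' f).
    by rewrite !tag_exp_facet => /(_ gt erefl); rewrite ltnNge le.
  (* Same position: lowering one coordinate from [r' v] to [r v] lowers the level. *)
  - have eF : F' = F by rewrite -(nth_index set0 F'f) -e nth_index.
    rewrite eF in ne le *; rewrite !keyE leq_add2l !level_exp_facet in le.
    have [v vF lt] := level_lower le ne.
    have rv : r v != r' v by rewrite -val_eqE ltn_eqF.
    exists (Tagged (fun i => 'I_(s i)) (r' v)).
      by rewrite inE !in_exp_facet /= vF eqxx (negPf rv).
    exists (exp_facet F [ffun i => if i == v then r i else r' i]); split.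
    + by apply: imset2_f => //; rewrite inE.
    + rewrite !keyE ltn_add2l !level_exp_facet (bigD1 v) // [ltnRHS](bigD1 v) //=.
      rewrite ffunE eqxx -addSn leq_add // leq_eqVlt; apply/orP; left; apply/eqP.
      by apply: eq_bigr => i /andP[_ /negPf iv]; rewrite ffunE iv.
    + exact: exp_facet_lower.
pose le G H := (key G <= key H)%N.
pose fs := sort le (enum (exp_facets s D)).
have fsE : fs =i exp_facets s D by move=> H; rewrite mem_sort mem_enum.
have ufs : uniq fs by rewrite sort_uniq enum_uniq.
have sfs : sorted le fs by apply: sort_sorted => G H; apply: leq_total.
have le_trans : transitive le by move=> ? ? ?; apply: leq_trans.
have le_refl : reflexive le by move=> ?; apply: leqnn.
exists fs; first by split=> // H; rewrite fsE facets_expansion.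
move=> i j /andP[ij jfs]; have ifs := ltn_trans ij jfs.
have [||||v vH [L [LD Lkey HL]]] := main (nth set0 fs i) (nth set0 fs j).
- by rewrite -fsE mem_nth.
- by rewrite -fsE mem_nth.
- by rewrite nth_uniq // ltn_eqF.
- by apply: (sorted_leq_nth le_trans le_refl); rewrite ?inE // ltnW.
(* The key of [L] is strictly smaller, so [L] comes before position [j] however ties are broken. *)
exists v => //; exists (index L fs); last by rewrite nth_index ?fsE.
rewrite ltnNge; apply/negP => jL.
have : le (nth set0 fs j) (nth set0 fs (index L fs)).
  by apply: (sorted_leq_nth le_trans le_refl); rewrite ?inE // index_mem fsE.
by rewrite nth_index ?fsE // /le leqNgt Lkey.
Qed.

End Expansions.

Theorem corollary2p13 (K : fieldType) (n : nat) (D : scomplex 'I_n) :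
  pure D -> shellable D ->
  forall s : 'I_n -> nat, (forall i : 'I_n, (0 < s i)%N) ->
  cohen_macaulay_over K (expansion s D).
Proof.
move=> pureD shD s s0; apply: pure_shellable_cohen_macaulay.
  exact: expansion_pure.
exact: expansion_shellable.
Qed.
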